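(* Let $n, s \in \mathbb{N}$ and let $g_1, \dots, g_s \in \mathbb{R}[\bar X] = \mathbb{R}[X_1, \dots, X_n]$ be such that $$\emptyset \ne S = \{\bar x \in \mathbb{R}^{n} \mid g_1(\bar x) \ge 0, \dots, g_s(\bar x) \ge 0\} \subset \widetilde{\Delta}_n^{\circ}$$ and such that the quadratic module $M(g_1, \dots, g_s)$ generated by $g_1, \dots, g_s$ in $\mathbb{R}[\bar X]$ is archimedean. Then there exists a positive constant $c$ (depending on $g_1, \dots, g_s$ but not on $f$) such that for every $f \in \mathbb{R}[\bar X, Y]$ positive on $S \times \mathbb{R}$, if $\deg_{\bar X} f = d$, $\deg_Y f = m$, $f$ is fully $m$-ic on $S$ and $$f^{\bullet} = \min\{\bar f(\bar x, y, z) \mid \bar x \in S,\ (y,z) \in C\} > 0,$$ then $f$ can be written as $$f = \sigma_0 + \sigma_1 g_1 + \dots + \sigma_s g_s \in M_{\mathbb{R}[\bar X, Y]}(g_1, \dots, g_s)$$ with $\sigma_0, \sigma_1, \dots, \sigma_s \in \sum \mathbb{R}[\bar X, Y]^2$ and $$\deg(\sigma_0), \deg(\sigma_1 g_1), \dots, \deg(\sigma_s g_s) \le c\,(m+1)\,2^{\frac{m}{2}}\, \mathrm{e}^{\left( \frac{\|f\|_{\bullet}(m+1)d^2}{f^{\bullet}} \right)^{c}}.$$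
   Context: $\bar X = (X_1,\dots,X_n)$; $\mathrm{e}$ is the base of the natural logarithm; $\sum A^2$ denotes the set of finite sums of squares of elements of a ring $A$; $\deg$ is total degree, and $\deg_{\bar X}$, $\deg_Y$ are the degrees in the variables $\bar X$ (total) and $Y$ respectively. $\widetilde{\Delta}_n = \{\bar x \in \mathbb{R}^n \mid \sum_{1 \le i \le n} x_i \le 1 \text{ and } x_i \ge 0 \text{ for } 1 \le i \le n\}$, and $\widetilde{\Delta}_n^{\circ}$ is its interior in $\mathbb{R}^n$. The quadratic module generated by $g_1,\dots,g_s$ in $\mathbb{R}[\bar X]$ is $M(g_1,\dots,g_s) = \{\sigma_0 + \sigma_1 g_1 + \dots + \sigma_s g_s \mid \sigma_0,\dots,\sigma_s \in \sum \mathbb{R}[\bar X]^2\}$. It is archimedean if there exists $N \in \mathbb{R}_{>0}$ with $N - X_1^2 - \dots - X_n^2 \in M(g_1,\dots,g_s)$. Similarly, $M_{\mathbb{R}[\bar X,Y]}(g_1,\dots,g_s) = \{\sigma_0 + \sigma_1 g_1 + \dots + \sigma_s g_s \mid \sigma_0,\dots,\sigma_s \in \sum \mathbb{R}[\bar X,Y]^2\}$. A polynomial $f \in \mathbb{R}[\bar X, Y]$ with $m = \deg_Y f$ is fully $m$-ic on $S$ if for every $\bar x \in S$ the univariate polynomial $f(\bar x, Y) \in \mathbb{R}[Y]$ has degree $m$. For $f = \sum_{0 \le i \le m} f_i(\bar X) Y^i \in \mathbb{R}[\bar X, Y]$ with $f_m \ne 0$, $\bar f = \sum_{0 \le i \le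 m} f_i(\bar X) Y^i Z^{m-i} \in \mathbb{R}[\bar X, Y, Z]$ is its homogenization with respect to $Y$. Also $C = \{(y,z) \in \mathbb{R}^2 \mid y^2 + z^2 = 1\}$. Norm: writing $$f = \sum_{0 \le i \le m}\ \sum_{\alpha \in \mathbb{N}_0^n,\, |\alpha| \le d} \binom{|\alpha|}{\alpha} a_{\alpha,i} \bar X^\alpha Y^i,$$ where $|\alpha| = \alpha_1 + \dots + \alpha_n$ and $\binom{|\alpha|}{\alpha} = \frac{|\alpha|!}{\alpha_1! \cdots \alpha_n!}$, set $\|f\|_{\bullet} = \max\{|a_{\alpha,i}| \mid 0 \le i \le m,\ \alpha \in \mathbb{N}_0^n,\ |\alpha| \le d\}$. *)

(* Defs.v *)
(* mpoly has to be imported before mathcomp-analysis: the grammar conflict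
   between the two is an error only in the opposite order. *)
From mathcomp Require Import all_boot all_order all_algebra.
From mathcomp Require Import mpoly.
From mathcomp Require Import all_classical all_reals all_analysis.

Set Implicit Arguments.
Unset Strict Implicit.
Unset Printing Implicit Defensive.

Import Order.TTheory GRing.Theory Num.Theory numFieldNormedType.Exports.

Local Open Scope classical_set_scope.
Local Open Scope ring_scope.

(* R[X_1, ..., X_n, Y] is represented by {poly {mpoly R[n]}}, with Y the variable
   of the univariate layer, so that f`_i is the coefficient f_i(X) of Y^i and
   g%:P is g in R[X] regarded as an element of R[X, Y].  Points of R^n are row
   vectors x : 'rV[R]_n, and x 0 is the family of coordinates of x. *)

Definition is_sos (A : pzRingType) (a : A) : Prop :=
  exists t : seq A, a = \sum_(q <- t) q ^+ 2.

Definition is_minimum (R : realType) (A : set R) (b : R) : Prop :=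
  A b /\ lbound A b.

Section Geometry.
Variables (R : realType) (n s : nat).

Definition simplex : set 'rV[R]_n :=
  [set x | \sum_(i < n) x 0 i <= 1 /\ forall i : 'I_n, 0 <= x 0 i].

Definition circle : set (R * R) := [set p | p.1 ^+ 2 + p.2 ^+ 2 = 1].

Definition semialg (g : 'I_s -> {mpoly R[n]}) : set 'rV[R]_n :=
  [set x | forall i : 'I_s, 0 <= (g i).@[x 0]].

End Geometry.

Arguments simplex : clear implicits.
Arguments circle : clear implicits.

Definition quadratic_module (A : comPzRingType) (s : nat) (g : 'I_s -> A) : set A :=
  [set p | exists (sigma0 : A) (sigma : 'I_s -> A),
     [/\ is_sos sigma0, forall i, is_sos (sigma i)
       & p = sigma0 + \sum_(i < s) sigma i * g i]].

Definition archimedean_qm (R : realType) (n s : nat)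
    (g : 'I_s -> {mpoly R[n]}) : Prop :=
  exists N : R, 0 < N /\
    quadratic_module g (N%:MP - \sum_(i < n) ('X_i : {mpoly R[n]}) ^+ 2).

Section Cylinder.
Variables (R : realType) (n : nat).
Implicit Types (f : {poly {mpoly R[n]}}) (x : 'rV[R]_n) (y z : R).

Definition degX f : nat := \max_(i < size f) (msize f`_i).-1.

Definition degY f : nat := (size f).-1.

(* The zero polynomial has degree 0 for degX, degY and degXY. *)
Definition degXY f : nat :=
  \max_(i < size f | f`_i != 0) ((msize f`_i).-1 + i)%N.

Definition evalXY f x y : R := f.[y%:MP].@[x 0].

Definition evalX f x : {poly R} := map_poly (meval (x 0)) f.

(* The size condition says that f(x, Y) is nonzero of degree exactly m; the
   condition on degrees alone would let f(x, Y) vanish when m = 0. *)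
Definition fully_mic (m : nat) (S : set 'rV[R]_n) f : Prop :=
  degY f = m /\ forall x, S x -> size (evalX f x) = m.+1.

(* In {poly {poly {mpoly R[n]}}} the outer variable is Y and the inner one Z. *)
Definition homogY f : {poly {poly {mpoly R[n]}}} :=
  \poly_(i < (degY f).+1) (f`_i *: 'X^(degY f - i)).

Definition evalXYZ (F : {poly {poly {mpoly R[n]}}}) x y z : R :=
  F.[(y%:MP)%:P].[z%:MP].@[x 0].

Definition multinomial_coef (a : 'X_{1..n}) : R :=
  (mdeg a)`!%:R / (\prod_(i < n) (a i)`!)%:R.

Definition bullet_norm f : R :=
  \big[Num.max/0]_(i < (degY f).+1)
    \big[Num.max/0]_(a : 'X_{1..n < (degX f).+1})
      `|f`_i@_a / multinomial_coef a|.

(* As S is not assumed compact here, the minimum need not exist in general, so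
   "b is the minimum" is a predicate rather than a function of f and S. *)
Definition is_bullet_min (S : set 'rV[R]_n) f (b : R) : Prop :=
  is_minimum [set evalXYZ (homogY f) p.1 p.2.1 p.2.2 | p in S `*` circle R] b.

End Cylinder.

(* Main.v *)
(* The idea is to subtract from f a penalty that makes it positive on a large
   simplex, and to certify positivity there by Polya's theorem.

   Choose N with u = N - |X|^2 in M(g_1, ..., g_s).  The quadratic module M(u) of
   the single element u is closed under products, so that it contains all
   products of the barycentric coordinates T_0, ..., T_n of a simplex containing
   the ball {u >= 0}, because each T_j is in M(u).  Rescale the g_j so that
   |g_j| <= 1 on this simplex, let m = 2h be the degree in Y (it is even since f
   is positive on S x R), and put

     p = f - lambda (1 + Y^2)^h sum_j g_j (1 - g_j)^(2k),  lambda = f^bullet / (4 s).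

   Near S, f is still at least (3/4) f^bullet (1 + Y^2)^h; away from S some g_j is
   below -1/q, where q is polynomial in the data by the Lojasiewicz inequality, and
   for k of the order of q times the logarithm of the size of f the penalty
   dominates f, even though f may be exponentially large on the simplex.  Hence
   p >= (f^bullet / 2) (1 + Y^2)^h on the simplex.  Polya's theorem with an
   explicit exponent, applied to the coefficients in Y, writes p as a sum of
   b_w(Y) T^w with b_w >= 0 on R, and each b_w is a sum of squares in R[Y].

   The Lojasiewicz inequality comes from quantifier elimination: for large b, the
   sign of a polynomial P(b, r) is constant for 0 < r < 1/(K b^K). *)
Require Import Defs.
From mathcomp Require Import all_boot all_order all_algebra.
From mathcomp Require Import mpoly.
From mathcomp Require Import all_classical all_reals all_analysis.
From mathcomp Require Import ring lra zify.
From mathcomp Require polyrcf ordered_qelim qe_rcf.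

Set Implicit Arguments.
Unset Strict Implicit.
Unset Printing Implicit Defensive.

Import Order.TTheory GRing.Theory Num.Theory numFieldNormedType.Exports.

Local Open Scope classical_set_scope.
Local Open Scope ring_scope.

(** * Words in a family of polynomials *)

(** The factor (1 - g)^(2k) is a square, so that the penalty lies in the module; it is at most 1
    where 0 <= g <= 1, so that g (1 - g)^(2k) never exceeds 1 there, whatever k; and it grows
    exponentially in k where g < 0. The price is a factor 4^k in the coefficients of p. Polya's
    exponent is proportional to the size of these coefficients: hence the exponential in the degree
    bound.

    The estimates need a size of polynomials that is controlled by ||f||_bullet, is
    submultiplicative and survives the change from the variables X_i to the coordinates T_j. It is
    obtained by writing polynomials as combinations of noncommutative words; the multinomial
    coefficients in ||f||_bullet count the words with a given content.

    All data are condensed into one integer a <= 2 E + 1, with E = ||f||_bullet (m + 1) d^2 /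
    f^bullet, that bounds d, m + 1 and ||f||_bullet / f^bullet. For d = 0 the quantity E vanishes
    and cannot bound anything, but then f is a polynomial in Y alone. *)

Section WordRepresentation.
Variables (R : realFieldType) (n : nat).

Lemma meval_sum (I : Type) (r : seq I) (P : pred I) (F : I -> {mpoly R[n]})
    (x : 'I_n -> R) :
  (\sum_(i <- r | P i) F i).@[x] = \sum_(i <- r | P i) (F i).@[x].
Proof. exact: raddf_sum. Qed.

Lemma meval_prod (I : Type) (r : seq I) (P : pred I) (F : I -> {mpoly R[n]})
    (x : 'I_n -> R) :
  (\prod_(i <- r | P i) F i).@[x] = \prod_(i <- r | P i) (F i).@[x].
Proof. exact: rmorph_prod. Qed.

(* P is a combination of words of length D in the T_j with coefficients bounded
   by L.  The least such L behaves like a submultiplicative norm. *)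
Fixpoint wrep (p : nat) (T : 'I_p -> {mpoly R[n]}) (D : nat) (L : R)
    (P : {mpoly R[n]}) : Prop :=
  if D is D'.+1 then
    exists2 Q : 'I_p -> {mpoly R[n]},
      forall j, wrep T D' L (Q j) & P = \sum_(j < p) T j * Q j
  else exists2 c : R, `|c| <= L & P = c%:MP.

Section Closure.
Variables (p : nat) (T : 'I_p -> {mpoly R[n]}).

Lemma wrep_le D L L' P : L <= L' -> wrep T D L P -> wrep T D L' P.
Proof.
move=> LL'; elim: D P => [|D IH] P /=.
  by case=> c cL ->; exists c => //; apply: le_trans LL'.
by case=> Q HQ ->; exists Q => // j; apply: IH.
Qed.

Lemma wrep0 D L : 0 <= L -> wrep T D L 0.
Proof.
move=> L0; elim: D => [|D IH] /=; first by exists 0; rewrite ?normr0 // mpolyC0.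
by exists (fun=> 0) => //; rewrite big1 // => j _; rewrite mulr0.
Qed.

Lemma wrepD D L L' P P' :
  wrep T D L P -> wrep T D L' P' -> wrep T D (L + L') (P + P').
Proof.
elim: D P P' => [|D IH] P P' /=.
  case=> c cL -> [c' cL' ->]; exists (c + c'); last by rewrite mpolyCD.
  by apply: (le_trans (ler_normD _ _)); apply: lerD.
case=> Q HQ -> [Q' HQ' ->]; exists (fun j => Q j + Q' j).
  by move=> j; apply: IH.
by rewrite -big_split; apply: eq_bigr => j _; rewrite mulrDr.
Qed.

Lemma wrepZ D L c P : wrep T D L P -> wrep T D (`|c| * L) (c *: P).
Proof.
elim: D P => [|D IH] P /=.
  case=> b bL ->; exists (c * b); first by rewrite normrM ler_wpM2l.
  by rewrite -mul_mpolyC -mpolyCM.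
case=> Q HQ ->; exists (fun j => c *: Q j); first by move=> j; apply: IH.
by rewrite scaler_sumr; apply: eq_bigr => j _; rewrite scalerAr.
Qed.

Lemma wrep_sum (I : Type) (r : seq I) (F : I -> {mpoly R[n]}) (L : I -> R) D :
  (forall i, wrep T D (L i) (F i)) ->
  wrep T D (\sum_(i <- r) L i) (\sum_(i <- r) F i).
Proof.
move=> H; elim: r => [|i r IH]; first by rewrite !big_nil; apply: wrep0.
by rewrite !big_cons; apply: wrepD.
Qed.


Lemma wrepM D E L M P Q : 0 <= M ->
  wrep T D L P -> wrep T E M Q -> wrep T (D + E) (L * M) (P * Q).
Proof.
move=> M0 HP HQ; elim: D P HP => [|D IH] P /=.
  case=> c cL ->; rewrite add0n mul_mpolyC.
  by apply: wrep_le (wrepZ c HQ); apply: ler_wpM2r.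
case=> P' HP' ->; exists (fun j => P' j * Q); first by move=> j; apply: IH.
by rewrite mulr_suml; apply: eq_bigr => j _; rewrite mulrA.
Qed.

Lemma wrep_exp D L P k : 0 <= L -> wrep T D L P -> wrep T (D * k) (L ^+ k) (P ^+ k).
Proof.
move=> L0 HP; elim: k => [|k IH].
  by rewrite muln0 !expr0 /=; exists 1; rewrite ?normr1 // mpolyC1.
by rewrite mulnS !exprS; apply: wrepM => //; apply: exprn_ge0.
Qed.

(** Multiplying by 1 = sum_j T_j adds a letter to each word without enlarging the coefficients;
    lengths can thus be equalised before adding. *)
Lemma wrep_pad D E L P : \sum_j T j = 1 -> (D <= E)%N ->
  wrep T D L P -> wrep T E L P.
Proof.
move=> T1 /subnK <- HP; elim: (E - D)%N => [|k IH] //.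
by rewrite addSn /=; exists (fun=> P) => //; rewrite -mulr_suml T1 mul1r.
Qed.

Lemma wrep_eval_le D L P (x : 'I_n -> R) s : 0 <= L ->
  \sum_(j < p) `|(T j).@[x]| <= s -> wrep T D L P -> `|P.@[x]| <= L * s ^+ D.
Proof.
move=> L0 Hs; elim: D P => [|D IH] P /=.
  by case=> c cL ->; rewrite mevalC expr0 mulr1.
case=> Q HQ ->; rewrite meval_sum; apply: (le_trans (ler_norm_sum _ _ _)).
have s0 : 0 <= s by apply: le_trans Hs; apply: sumr_ge0.
apply: (@le_trans _ _ (\sum_(j < p) `|(T j).@[x]| * (L * s ^+ D))).
  apply: ler_sum => j _; rewrite mevalM normrM ler_wpM2l //; exact: IH.
rewrite -mulr_suml exprS [leRHS]mulrCA ler_wpM2r //.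
by rewrite mulr_ge0 // exprn_ge0.
Qed.

(** The product rule is applied to one letter at a time. Each of the D letters contributes at most L
    s^D e, where s >= 1 allows the powers of s to be rounded up. *)
Lemma wrep_lipschitz D L P (x y : 'I_n -> R) s e : 0 <= L -> 1 <= s ->
  \sum_(j < p) `|(T j).@[x]| <= s -> \sum_(j < p) `|(T j).@[y]| <= s ->
  \sum_(j < p) `|(T j).@[x] - (T j).@[y]| <= e ->
  wrep T D L P -> `|P.@[x] - P.@[y]| <= L * D%:R * s ^+ D * e.
Proof.
move=> L0 s1 Hx Hy He; have s0 : 0 <= s by apply: le_trans s1.
have e0 : 0 <= e by apply: le_trans He; apply: sumr_ge0.
elim: D P => [|D IH] P /=.
  by case=> c cL ->; rewrite !mevalC subrr normr0 mulr0 !mul0r.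
case=> Q HQ ->; rewrite !meval_sum -sumrB; apply: (le_trans (ler_norm_sum _ _ _)).
apply: (@le_trans _ _ (\sum_(j < p) (`|(T j).@[x] - (T j).@[y]| * (L * s ^+ D)
    + `|(T j).@[y]| * (L * D%:R * s ^+ D * e)))).
  apply: ler_sum => j _; rewrite !mevalM.
  have -> : (T j).@[x] * (Q j).@[x] - (T j).@[y] * (Q j).@[y] =
    ((T j).@[x] - (T j).@[y]) * (Q j).@[x] +
    (T j).@[y] * ((Q j).@[x] - (Q j).@[y]) by ring.
  apply: (le_trans (ler_normD _ _)); rewrite !normrM lerD // ler_wpM2l //.
    exact: wrep_eval_le (HQ j).
  exact: IH.
rewrite big_split /= -!mulr_suml.
have sD0 : 0 <= s ^+ D by apply: exprn_ge0.
apply: (@le_trans _ _ (e * (L * s ^+ D) + s * (L * D%:R * s ^+ D * e))).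
  by apply: lerD; rewrite ler_wpM2r // ?mulr_ge0.
rewrite -natr1 exprS.
have -> : L * (D%:R + 1) * (s * s ^+ D) * e =
   s * (e * (L * s ^+ D)) + s * (L * D%:R * s ^+ D * e) by ring.
by rewrite lerD2r ler_peMl // !mulr_ge0.
Qed.

Definition wcons D (j : 'I_p) (v : {ffun 'I_D -> 'I_p}) : {ffun 'I_D.+1 -> 'I_p} :=
  [ffun i => if unlift ord0 i is Some i' then v i' else j].

(** Words are functions, not multisets of letters, so each is reached along a single branch of
    [wrep] and keeps its own coefficient. Identifying permuted words would add coefficients up and
    lose the bound L. *)
Lemma wrep_words D L P : wrep T D L P ->
  exists2 a : {ffun 'I_D -> 'I_p} -> R, forall v, `|a v| <= L &
    P = \sum_v a v *: \prod_i T (v i).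
Proof.
elim: D P => [|D IH] P /=.
  case=> c cL ->; exists (fun=> c) => //.
  rewrite (eq_bigr (fun=> c%:MP)) => [|v _]; last by rewrite big_ord0 alg_mpolyC.
  rewrite big_const card_ffun !card_ord expn0 /= addr0 //.
case=> Q HQ ->.
have {}HQ j := IH _ (HQ j).
pose a j := sval (cid2 (HQ j)).
have aL j v : `|a j v| <= L by rewrite /a; case: cid2.
have QE j : Q j = \sum_v a j v *: \prod_i T (v i).
  by rewrite /a; case: cid2.
exists (fun v => a (v ord0) [ffun i => v (lift ord0 i)]) => [v|]; first exact: aL.
rewrite (eq_bigr (fun j => \sum_v a j v *: (T j * \prod_i T (v i)))); last first.
  by move=> j _; rewrite QE mulr_sumr; apply: eq_bigr => v _; rewrite scalerAr.
rewrite pair_big /=.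
rewrite (reindex (fun v : {ffun 'I_D.+1 -> 'I_p} =>
  (v ord0, [ffun i => v (lift ord0 i)]))) /=.
  apply: eq_bigr => v _; rewrite big_ord_recl; congr (_ *: (_ * _)).
  by apply: eq_bigr => i _; rewrite ffunE.
exists (fun jv => wcons jv.1 jv.2) => [v|[j v]] _ /=.
  by apply/ffunP => i; rewrite ffunE; case: unliftP => [i'|] ->; rewrite ?ffunE.
congr (_, _); first by rewrite ffunE unlift_none.
by apply/ffunP => i; rewrite !ffunE liftK.
Qed.

End Closure.

(** Summing over the p letters that may stand at a position, each rewritten with coefficients at
    most C, costs a factor p C per position. *)
Lemma wrep_subst p q (T : 'I_p -> {mpoly R[n]}) (T' : 'I_q -> {mpoly R[n]}) D L C P :
  0 <= L -> 0 <= C ->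
  (forall j, wrep T' 1 C (T j)) -> wrep T D L P ->
  wrep T' D (L * (p%:R * C) ^+ D) P.
Proof.
move=> L0 C0 HT; elim: D P => [|D IH] P.
  by rewrite expr0 mulr1.
case=> Q HQ ->; have K0 : 0 <= L * (p%:R * C) ^+ D.
  by rewrite mulr_ge0 // exprn_ge0 // mulr_ge0.
have -> : L * (p%:R * C) ^+ D.+1 = \sum_(j < p) C * (L * (p%:R * C) ^+ D).
  by rewrite sumr_const card_ord exprS -mulr_natl; ring.
apply: wrep_sum => j; rewrite -[D.+1]/(1 + D)%N.
by apply: wrepM => //; apply: IH; apply: HQ.
Qed.

End WordRepresentation.

(** * Polya's theorem *)

Section Polya.
Variables (R : realFieldType) (n p : nat) (T : 'I_p -> {mpoly R[n]}).
Hypothesis T1 : \sum_j T j = 1.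

Definition wcomp D N (w : {ffun 'I_N -> 'I_p}) (f : {ffun 'I_D -> 'I_N}) :
  {ffun 'I_D -> 'I_p} := [ffun i => w (f i)].

(* The letters of w outside the image of f sum up to powers of sum_j T_j = 1. *)
Lemma sum_words_injection D N (a : {ffun 'I_D -> 'I_p} -> R)
    (f : {ffun 'I_D -> 'I_N}) : injective f ->
  \sum_w a (wcomp w f) *: \prod_k T (w k) = \sum_v a v *: \prod_i T (v i).
Proof.
move=> finj; rewrite (partition_big (fun w => wcomp w f) predT) //=.
apply: eq_bigr => v _.
rewrite (eq_bigr (fun w : {ffun 'I_N -> 'I_p} => a v *: \prod_k T (w k))); last first.
  by move=> w /eqP ->.
rewrite -scaler_sumr; congr (_ *: _).
pose Q (k : 'I_N) : pred 'I_p := fun j => [forall i, (f i == k) ==> (j == v i)].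
rewrite (eq_bigl (fun w : {ffun 'I_N -> 'I_p} => w \in family Q)); last first.
  move=> w; apply/eqP/familyP => [wv k|H].
    by apply/forallP => i; apply/implyP => /eqP <-; rewrite -wv ffunE.
  apply/ffunP => i; rewrite ffunE.
  by have /forallP/(_ i) := H (f i); rewrite eqxx => /eqP.
rewrite -(bigA_distr_big_dep _ (fun _ j => T j)) /=.
rewrite (bigID (fun k => k \in f @: [set: 'I_D]%SET)) /=.
rewrite [X in _ * X]big1 ?mulr1; last first.
  move=> k kf; rewrite -[RHS]T1; apply: eq_bigl => j; apply/forallP => i.
  by apply/implyP => /eqP fik; case/negP: kf; rewrite -fik imset_f.
rewrite big_imset /=; last by move=> i i' _ _; apply: finj.
apply: eq_big => [i|i _]; first by rewrite inE.
rewrite (big_pred1 (v i)) // => j.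
apply/forallP/eqP => [/(_ i)|-> i']; first by rewrite eqxx => /eqP.
by apply/implyP => /eqP/finj ->.
Qed.

(** Expanding the product over i of the number of positions k with w k = v i counts the maps f such
    that w o f = v. *)
Lemma meval_frequency D N (a : {ffun 'I_D -> 'I_p} -> R)
    (w : {ffun 'I_N -> 'I_p}) (x : 'I_n -> R) :
  (forall j, (T j).@[x] = #|[pred k | w k == j]|%:R / N%:R) ->
  (\sum_v a v *: \prod_i T (v i)).@[x] = (\sum_f a (wcomp w f)) / N%:R ^+ D.
Proof.
move=> HT; rewrite meval_sum.
have E (v : {ffun 'I_D -> 'I_p}) : (a v *: \prod_i T (v i)).@[x] =
  \sum_(f : {ffun 'I_D -> 'I_N}) (a v * (wcomp w f == v)%:R) / N%:R ^+ D.
  rewrite mevalZ meval_prod -mulr_suml -mulr_sumr -mulrA; congr (_ * _).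
  rewrite (eq_bigr (fun i => (\sum_k (w k == v i)%:R) / N%:R)); last first.
    move=> i _; rewrite HT -sum1_card natr_sum big_mkcond; congr (_ / _).
    by apply: eq_bigr => k _; rewrite inE; case: eqP.
  rewrite big_split /= prodr_const card_ord exprVn; congr (_ / _).
  rewrite bigA_distr_bigA /=; apply: eq_bigr => f _.
  have [<-|wv] := eqVneq (wcomp w f) v.
    by rewrite big1 // => i _; rewrite ffunE eqxx.
  have /existsP[i wvi] : [exists i, w (f i) != v i].
    apply: contraNT wv; rewrite negb_exists => /forallP H.
    by apply/eqP/ffunP => i; rewrite ffunE; apply/eqP; have := H i; rewrite negbK.
  by rewrite (bigD1 i) //= (negbTE wvi) mul0r.
rewrite (eq_bigr _ (fun v _ => E v)) exchange_big /= mulr_suml.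
apply: eq_bigr => f _; rewrite -mulr_suml; congr (_ / _).
rewrite (bigD1 (wcomp w f)) //= eqxx mulr1 big1 ?addr0 // => v.
by rewrite eq_sym => /negbTE ->; rewrite mulr0.
Qed.

Lemma ffact_ge D N : (0 < N)%N ->
  (1 - D%:R ^+ 2 / N%:R) * N%:R ^+ D <= (N ^_ D)%:R :> R.
Proof.
move=> N0; have N0' : 0 < N%:R :> R by rewrite ltr0n.
elim: D => [|D IH]; first by rewrite expr0n /= mul0r subr0 mul1r expr0 ffactn0.
have [ND|DN] := leqP N D.
  apply: (@le_trans _ _ 0); last by [].
  rewrite mulr_le0_ge0 ?exprn_ge0 // subr_le0 ler_pdivlMr // mul1r.
  rewrite -natrX ler_nat; nia.
rewrite ffactnSr natrM natrB 1?ltnW //.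
have D1 : (D.+1)%:R = D%:R + 1 :> R by rewrite -natr1.
have ND' : 0 <= N%:R - D%:R :> R by rewrite subr_ge0 ler_nat ltnW.
apply: le_trans (ler_wpM2r ND' IH).
set P := _ ^+ D; have P0 : 0 <= P by rewrite exprn_ge0.
rewrite [N%:R ^+ D.+1]exprSr D1 -/P [leLHS]mulrCA [leRHS]mulrAC [leRHS]mulrC ler_wpM2l //.
have D0 : 0 <= D%:R :> R by [].
have -> : (1 - (D%:R + 1) ^+ 2 / N%:R) * N%:R = N%:R - (D%:R + 1) ^+ 2 :> R.
  by field; rewrite gt_eqF.
have -> : (1 - D%:R ^+ 2 / N%:R) * (N%:R - D%:R) =
  N%:R - D%:R - D%:R ^+ 2 + D%:R ^+ 3 / N%:R :> R.
  by field; rewrite gt_eqF.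
have : 0 <= D%:R ^+ 3 / N%:R :> R by rewrite divr_ge0 ?exprn_ge0.
nra.
Qed.

(* The coefficient of the word w is the mean of a (w o f) over the injections
   f : 'I_D -> 'I_N, while the value of P at the point of frequencies of w is the
   mean over all maps f; a proportion of at most D^2 / N of the maps is not
   injective. *)
Lemma polya_words D N (L : R) P : (0 < N)%N -> (D <= N)%N -> 0 <= L -> wrep T D L P ->
  exists2 b : {ffun 'I_N -> 'I_p} -> R,
    P = \sum_w b w *: \prod_k T (w k) &
    forall (w : {ffun 'I_N -> 'I_p}) (x : 'I_n -> R),
      (forall j, (T j).@[x] = #|[pred k | w k == j]|%:R / N%:R) ->
      `|b w - P.@[x]| <= 2 * L * D%:R ^+ 2 / N%:R.
Proof.
move=> N0 DN L0 /wrep_words[a aL PE].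
have N0' : 0 < N%:R :> R by rewrite ltr0n.
have NI0 : 0 < (N ^_ D)%:R :> R by rewrite ltr0n ffact_gt0.
pose I := [set f : {ffun 'I_D -> 'I_N} | injectiveb f]%SET.
have cI : #|I| = N ^_ D by rewrite card_inj_ffuns !card_ord.
exists (fun w => (\sum_(f in I) a (wcomp w f)) / (N ^_ D)%:R).
  rewrite (eq_bigr (fun w : {ffun 'I_N -> 'I_p} => (N ^_ D)%:R^-1 *:
      \sum_(f in I) a (wcomp w f) *: \prod_k T (w k))); last first.
    by move=> w _; rewrite mulrC -scalerA scaler_suml.
  rewrite -scaler_sumr exchange_big /= (eq_bigr (fun=> P)); last first.
    by move=> f; rewrite inE => /injectiveP finj; rewrite sum_words_injection.
  by rewrite sumr_const cI -scalerMnr scalerMnl -mulr_natr mulVf ?scale1r // gt_eqF.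
move=> w x HT; rewrite PE (meval_frequency _ HT).
set M := N%:R ^+ D; set J := (N ^_ D)%:R.
have M0 : 0 < M by rewrite exprn_gt0.
have JM : (1 - D%:R ^+ 2 / N%:R) * M <= J := ffact_ge D N0.
set q := D%:R ^+ 2 / N%:R in JM *.
rewrite (bigID (mem I) predT) /=.
set s1 := \sum_(f in I) _; set s2 := \sum_(f | f \notin I) _.
have s1L : `|s1| <= J * L.
  apply: (le_trans (ler_norm_sum _ _ _)).
  apply: (@le_trans _ _ (\sum_(f in I) L)); first exact: ler_sum.
  by rewrite sumr_const cI mulr_natl.
have s2L : `|s2| <= (M - J) * L.
  apply: (le_trans (ler_norm_sum _ _ _)).
  apply: (@le_trans _ _ (\sum_(f in ~: I) L)).
    rewrite (eq_bigl (fun f => f \in ~: I)); first exact: ler_sum.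
    by move=> f; rewrite finset.in_setC.
  rewrite sumr_const -[_ *+ _]mulr_natl ler_wpM2r //.
  rewrite lerBrDr -natrD -cI addnC cardsC card_ffun !card_ord natrX //.
have JM1 : J <= M.
  have := le_trans (normr_ge0 _) s2L.
  have [->|Lne] := eqVneq L 0; last first.
    by rewrite pmulr_lge0 ?subr_ge0 // lt0r Lne.
  move=> _; rewrite /J /M -natrX ler_nat -[in leqRHS](card_ord N) -[in leqRHS](card_ord D).
  by rewrite -card_ffun -cI max_card.
(* Each of the two terms is at most L (M - J) / M in absolute value, whence the factor 2 in the
   error. *)
have -> : s1 / J - (s1 + s2) / M = s1 * (J^-1 - M^-1) - s2 / M by ring.
apply: (le_trans (ler_normB _ _)); rewrite !normrM.
have MJ : 0 <= J^-1 - M^-1 by rewrite subr_ge0 lef_pV2.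
have Mi : 0 <= M^-1 by rewrite invr_ge0 ltW.
rewrite (ger0_norm MJ) (ger0_norm Mi).
apply: (@le_trans _ _ (J * L * (J^-1 - M^-1) + (M - J) * L / M)).
  by apply: lerD; rewrite ler_wpM2r // invr_ge0 ltW.
have -> : J * L * (J^-1 - M^-1) + (M - J) * L / M = 2 * L * ((M - J) / M).
  by field; rewrite !gt_eqF.
rewrite -[leRHS]mulrA -/q ler_wpM2l ?mulr_ge0 // ler_pdivrMr //.
by move: JM; rewrite mulrBl mul1r lerBlDl lerBlDr addrC.
Qed.

End Polya.

(** * Quantifier elimination and signs near r = 0 *)

Module qe := mathcomp.real_closed.qe_rcf.
Module ord := mathcomp.real_closed.ordered_qelim.ord.

Section SignStability.
Variable R : realType.

(** The single [K] serves as threshold for b, as constant and as exponent, so that the bounds for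
    subformulas combine by [maxn]. The range of r shrinks only polynomially in b; this becomes the
    polynomial rate in the Lojasiewicz inequality. *)
Definition stable (T : Type) (V : R -> R -> T) : Prop :=
  exists K : nat, forall b r r', (K <= b)%N -> (0 < b)%N ->
    0 < r -> r * (K%:R * b%:R ^+ K) <= 1 ->
    0 < r' -> r' * (K%:R * b%:R ^+ K) <= 1 -> V b%:R r = V b%:R r'.

Lemma stable_comp2 (T T' T'' : Type) (V : R -> R -> T) (V' : R -> R -> T')
    (F : T -> T' -> T'') :
  stable V -> stable V' -> stable (fun b r => F (V b r) (V' b r)).
Proof.
have weaken K K' b (r : R) : (0 < b)%N -> (K <= K')%N ->
    0 < r -> r * (K'%:R * b%:R ^+ K') <= 1 -> r * (K%:R * b%:R ^+ K) <= 1.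
  move=> b0 KK' r0; apply: le_trans; rewrite ler_pM2l // -!natrX -!natrM ler_nat.
  by rewrite leq_mul // leq_pexp2l.
move=> [K HK] [K' HK']; exists (maxn K K') => b r r' Kb b0 r0 Hr r'0 Hr'.
have [L L'] := (leq_maxl K K', leq_maxr K K').
by rewrite (HK b r r') ?(HK' b r r') // ?(leq_trans _ Kb) //;
   apply: (@weaken _ (maxn K K')).
Qed.

Lemma stable_comp (T T' : Type) (V : R -> R -> T) (F : T -> T') :
  stable V -> stable (fun b r => F (V b r)).
Proof.
by move=> [K HK]; exists K => b r r' *; congr F; apply: HK.
Qed.

Lemma poly_nat_lower_bound (q : {poly R}) : q != 0 ->
  exists2 c : R, 0 < c & exists B : nat, forall b : nat, (B <= b)%N -> c <= `|q.[b%:R]|.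
Proof.
elim/poly_ind: q => [|q a IH]; first by rewrite eqxx.
have [->|q0 _] := eqVneq q 0.
  rewrite mul0r add0r polyC_eq0 => a0; exists `|a|; first by rewrite normr_gt0.
  by exists 0%N => b _; rewrite hornerC.
have [c c0 [B HB]] := IH q0.
exists 1 => //; exists (maxn B (Num.truncn ((`|a| + 1) / c)).+1) => b.
rewrite geq_max => /andP[Bb ab]; rewrite hornerMXaddC.
have b0 : 0 <= (`|a| + 1) / c by rewrite divr_ge0 // ?ltW // addr_ge0.
have : `|a| + 1 <= c * b%:R.
  rewrite mulrC -ler_pdivrMr //; apply/ltW/(lt_le_trans (truncnS_gt _)).
  by rewrite ler_nat.
move=> H; have := ler_wpM2r (ler0n _ b) (HB b Bb).
have := lerB_dist (q.[b%:R] * b%:R) (- a); rewrite opprK normrN normrM normr_nat.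
lra.
Qed.

Lemma bipoly_upper_bound (P : {poly {poly R}}) : exists2 C : R, 0 <= C &
  exists M : nat, forall (b : nat) (r : R), (0 < b)%N -> 0 <= r <= 1 ->
    `|P.[r%:P].[b%:R]| <= C * b%:R ^+ M.
Proof.
have upper (q : {poly R}) : exists2 C : R, 0 <= C &
    exists M : nat, forall b : nat, (0 < b)%N -> `|q.[b%:R]| <= C * b%:R ^+ M.
  exists (\sum_(i < size q) `|q`_i|); first exact: sumr_ge0.
  exists (size q) => b b0; rewrite horner_coef; apply: (le_trans (ler_norm_sum _ _ _)).
  rewrite mulr_suml; apply: ler_sum => i _; rewrite normrM ler_wpM2l // normrX normr_nat.
  by rewrite ler_weXn2l ?ler1n // ltnW.
elim/poly_ind: P => [|P q [C C0 [M HM]]].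
  by exists 0 => //; exists 0%N => b r _ _; rewrite !horner0 normr0 mul0r.
have [C' C'0 [M' HM']] := upper q.
exists (C + C'); first exact: addr_ge0.
exists (maxn M M') => b r b0 r01; rewrite hornerMXaddC hornerD hornerM hornerC.
have Hr : `|r| <= 1 by case/andP: r01 => r0 r1; rewrite ger0_norm.
have B1 : 1 <= b%:R :> R by rewrite ler1n.
apply: (le_trans (ler_normD _ _)); rewrite mulrDl; apply: lerD.
  rewrite normrM; apply: (@le_trans _ _ (C * b%:R ^+ M)).
    by rewrite -[leRHS]mulr1; apply: ler_pM => //; apply: HM.
  by rewrite ler_wpM2l // ler_weXn2l // leq_maxl.
apply: (le_trans (HM' b b0)); by rewrite ler_wpM2l // ler_weXn2l // leq_maxr.
Qed.

(* Write P = P' r + q(b): if q <> 0, then q(b) dominates P' r, and otherwise P has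
   the sign of P'. *)
Lemma stable_sgr (P : {poly {poly R}}) : stable (fun b r => Num.sg P.[r%:P].[b]).
Proof.
elim/poly_ind: P => [|P q IH].
  by exists 0%N => *; rewrite !horner0.
have [->|q0] := eqVneq q 0.
  case: IH => K HK; exists K => b r r' Kb b0 r0 Hr r'0 Hr'.
  rewrite !addr0 !hornerMX !hornerM !hornerC !sgrM (gtr0_sg r0) (gtr0_sg r'0) !mulr1.
  exact: HK.
have [c c0 [B HB]] := poly_nat_lower_bound q0.
have [C C0 [M HM]] := bipoly_upper_bound P.
pose k := (Num.truncn (C / c)).+1.
exists (maxn (maxn B M) k) => b r r' Kb b0.
suff H x : 0 < x -> x * ((maxn (maxn B M) k)%:R * b%:R ^+ maxn (maxn B M) k) <= 1 ->
    Num.sg (P * 'X + q%:P).[x%:P].[b%:R] = Num.sg q.[b%:R].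
  by move=> r0 Hr r'0 Hr'; rewrite !H.
move=> x0; set K := maxn _ k; move=> Hx; rewrite hornerMXaddC hornerD hornerM hornerC.
have B1 : 1 <= b%:R :> R by rewrite ler1n.
have K1 : 1 <= K%:R :> R by rewrite ler1n /K leq_max orbT.
have KM : b%:R ^+ M <= b%:R ^+ K :> R.
  by rewrite ler_weXn2l // /K !leq_max leqnn orbT.
have bK1 : 1 <= b%:R ^+ K :> R by rewrite exprn_ege1.
have x1 : x <= 1.
  by apply: le_trans Hx; rewrite ler_pMr // mulr_ege1.
have qc : c <= `|q.[b%:R]|.
  apply: HB; apply: leq_trans Kb; by rewrite /K !leq_max leqnn.
have CK : C < c * K%:R.
  rewrite mulrC -ltr_pdivrMr //; apply: (lt_le_trans (truncnS_gt _)).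
  by rewrite ler_nat leq_maxr.
have small : `|P.[x%:P].[b%:R] * x| < c.
  rewrite normrM (gtr0_norm x0).
  have x01 : 0 <= x <= 1 by rewrite x1 ltW.
  have Pb := HM b x b0 x01.
  apply: (@le_lt_trans _ _ (C * b%:R ^+ K * x)).
    apply: (ler_wpM2r (ltW x0)); apply: (le_trans Pb); exact: ler_wpM2l.
  apply: (@lt_le_trans _ _ (c * K%:R * b%:R ^+ K * x)).
    by rewrite ltr_pM2r // ltr_pM2r // exprn_gt0 // (lt_le_trans ltr01).
  rewrite -[leRHS]mulr1 -!mulrA ler_pM2l //.
  by rewrite mulrA mulrC.
have {qc} : `|P.[x%:P].[b%:R] * x| < `|q.[b%:R]| by apply: lt_le_trans qc.
case: (ltrgt0P q.[b%:R]) => [q1|q1|->]; last by rewrite ltNge normr_ge0.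
  rewrite ltr_norml => /andP[? ?]; rewrite !gtr0_sg //; lra.
rewrite ltr_norml => /andP[? ?]; rewrite !ltr0_sg //; lra.
Qed.

Lemma rterm_bipoly (t : GRing.term R) : GRing.rterm t ->
  exists P : {poly {poly R}}, forall b r, GRing.eval [:: b; r] t = P.[r%:P].[b].
Proof.
elim: t => //=.
- move=> [|[|i]] _ /=; first by exists ('X)%:P => b r; rewrite hornerC hornerX.
    by exists 'X => b r; rewrite hornerX hornerC.
  (* A variable beyond the two entries of the environment takes the default value 0. *)
  by exists 0 => b r; rewrite !horner0 nth_nil.
- by move=> x _; exists (x%:P)%:P => b r; rewrite !hornerC.
- by move=> k _; exists (k%:R) => b r; rewrite -!polyC_natr !hornerC.
- move=> t IH u IH' /andP[/IH[P HP] /IH'[Q HQ]].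
  by exists (P + Q) => b r; rewrite !hornerD HP HQ.
- by move=> t IH /IH[P HP]; exists (- P) => b r; rewrite !hornerN HP.
- by move=> t IH k /IH[P HP]; exists (P *+ k) => b r; rewrite !hornerMn HP.
- move=> t IH u IH' /andP[/IH[P HP] /IH'[Q HQ]].
  by exists (P * Q) => b r; rewrite !hornerM HP HQ.
- by move=> t IH k /IH[P HP]; exists (P ^+ k) => b r; rewrite !horner_exp HP.
Qed.

Lemma stable_qf_eval (f : ord.formula R) : ord.qf_form f -> ord.rformula f ->
  stable (fun b r => ord.qf_eval [:: b; r] f).
Proof.
have stable_atom (t u : GRing.term R) (F : R -> bool) (V : R -> R -> bool) :
    GRing.rterm t -> GRing.rterm u ->
    (forall b r, V b r = F (Num.sg (GRing.eval [:: b; r] t - GRing.eval [:: b; r] u))) ->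
    stable V.
  move=> /rterm_bipoly[P HP] /rterm_bipoly[Q HQ] HV.
  have [K HK] := stable_sgr (P - Q).
  exists K => b r r' *; rewrite !HV !HP !HQ -!hornerN -!hornerD; congr F; exact: HK.
elim: f => //=.
- by move=> x _ _; exists 0%N.
- move=> t u _ /andP[rt ru]; apply: (stable_atom t u (fun s => s == 0)) => // b r.
  by rewrite sgr_eq0 subr_eq0.
- move=> t u _ /andP[rt ru]; apply: (stable_atom t u (fun s => s < 0)) => // b r.
  by rewrite sgr_lt0 subr_lt0.
- move=> t u _ /andP[rt ru]; apply: (stable_atom t u (fun s => s <= 0)) => // b r.
  by rewrite sgr_le0 subr_le0.
- move=> f IH g IH' /andP[/IH{}IH /IH'{}IH'] /andP[/IH{}IH /IH'{}IH'].
  exact: stable_comp2.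
- move=> f IH g IH' /andP[/IH{}IH /IH'{}IH'] /andP[/IH{}IH /IH'{}IH'].
  exact: stable_comp2.
- move=> f IH g IH' /andP[/IH{}IH /IH'{}IH'] /andP[/IH{}IH /IH'{}IH'].
  exact: stable_comp2.
- by move=> f IH qf rf; apply: stable_comp; apply: IH.
Qed.

(** R is real closed, so f is equivalent to a quantifier-free formula, whose truth value is a
    Boolean function of finitely many signs of polynomials in b and r. *)
Lemma stable_holds (f : ord.formula R) : ord.rformula f ->
  stable (fun b r => `[< ord.holds [:: b; r] f >]).
Proof.
move=> rf; pose q := ord.quantifier_elim (fun i bc => qe.qfr_to_formula (@qe.wproj R i bc)) f.
have /andP[qq rq] := ord.quantifier_elim_wf (@qe.wf_QE_wproj R) rf.
have [K HK] := stable_qf_eval qq rq.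
exists K => b r r' Kb b0 r0 Hr r'0 Hr'; have := HK b r r' Kb b0 r0 Hr r'0 Hr'.
have P e := ord.quantifier_elim_rformP (@qe.wf_QE_wproj R) (@qe.valid_QE_wproj R) e rf.
move=> E; apply/asbool_equiv_eq; split=> /P H; apply/P; first by rewrite -E.
by rewrite E.
Qed.

End SignStability.

(** * First-order definable conditions on finite lists of reals *)

Section Definability.
Variable R : realType.

(* e lists the values of the free variables 'X_0, ..., 'X_(k-1). *)
Definition definable (k : nat) (P : seq R -> Prop) : Prop :=
  exists2 f : ord.formula R, ord.rformula f &
    forall e, size e = k -> (ord.holds e f <-> P e).

Lemma definable_ext k P Q : (forall e, size e = k -> (P e <-> Q e)) ->
  definable k P -> definable k Q.
Proof.
by move=> PQ [f rf Hf]; exists f => // e ek; rewrite Hf // PQ.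
Qed.

Lemma definable_and k P Q : definable k P -> definable k Q ->
  definable k (fun e => P e /\ Q e).
Proof.
move=> [f rf Hf] [g rg Hg]; exists (ord.And f g); first by rewrite /= rf.
by move=> e ek /=; rewrite Hf // Hg.
Qed.

Lemma definable_imply k P Q : definable k P -> definable k Q ->
  definable k (fun e => P e -> Q e).
Proof.
move=> [f rf Hf] [g rg Hg]; exists (ord.Implies f g); first by rewrite /= rf.
by move=> e ek /=; rewrite Hf // Hg.
Qed.

Lemma definable_all (q k : nat) (P : 'I_q -> seq R -> Prop) :
  (forall j, definable k (P j)) -> definable k (fun e => forall j, P j e).
Proof.
elim: q P => [|q IH] P HP.
  by exists (ord.Bool true) => // e _ /=; split=> // _ [].
apply: definable_ext (definable_and (HP ord0)
  (IH (fun j => P (lift ord0 j)) (fun j => HP (lift ord0 j)))) => e _.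
split=> [[H0 H] j|H]; last by split=> [|j]; apply: H.
by case: (unliftP ord0 j) => [j'|] ->.
Qed.

(** The quantified variable has index [k], the first one not in use; on an environment of size
    exactly [k], assigning it amounts to appending a value. *)
Lemma definable_exists1 k P : definable k.+1 P ->
  definable k (fun e => exists v, P (rcons e v)).
Proof.
move=> [f rf Hf]; exists (ord.Exists k f) => // e ek /=.
have E v : set_nth 0 e k v = rcons e v.
  by rewrite set_nthE -ek ltnn subnn /= cats1.
by split=> -[v] H; exists v; move: H; rewrite E Hf // size_rcons ek.
Qed.

Lemma definable_forall1 k P : definable k.+1 P ->
  definable k (fun e => forall v, P (rcons e v)).
Proof.
move=> [f rf Hf]; exists (ord.Forall k f) => // e ek /=.
have E v : set_nth 0 e k v = rcons e v.
  by rewrite set_nthE -ek ltnn subnn /= cats1.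
by split=> H v; move: (H v); rewrite E Hf // size_rcons ek.
Qed.

Lemma definable_exists k l P : definable (k + l) P ->
  definable k (fun e => exists2 u, size u = l & P (e ++ u)).
Proof.
elim: l k P => [|l IH] k P HP.
  rewrite addn0 in HP; apply: definable_ext HP => e ek.
  split=> [H|[u /size0nil ->]]; last by rewrite cats0.
  by exists [::]; rewrite ?cats0.
rewrite -addSnnS in HP; apply: definable_ext (definable_exists1 (IH _ _ HP)) => e ek.
split=> [[v [u ul H]]|[[|v u] //= [ul] H]].
  by exists (v :: u); rewrite /= ?ul // -cat_rcons.
by exists v; exists u => //; rewrite cat_rcons.
Qed.

Lemma definable_forall k l P : definable (k + l) P ->
  definable k (fun e => forall u, size u = l -> P (e ++ u)).
Proof.
elim: l k P => [|l IH] k P HP.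
  rewrite addn0 in HP; apply: definable_ext HP => e ek.
  split=> [H u /size0nil ->|/(_ [::])]; first by rewrite cats0.
  by rewrite cats0; apply.
rewrite -addSnnS in HP; apply: definable_ext (definable_forall1 (IH _ _ HP)) => e ek.
split=> [H [|v u] //= [ul]|H v u ul].
  by rewrite -cat_rcons; apply: H.
by rewrite cat_rcons; apply: H; rewrite /= ul.
Qed.

Definition env_term (V : seq R -> R) : Prop :=
  exists2 t : GRing.term R, GRing.rterm t & forall e, GRing.eval e t = V e.

Lemma env_term_nth i : env_term (fun e => e`_i).
Proof. by exists (GRing.Var _ i). Qed.

Lemma env_term_cst c : env_term (fun=> c).
Proof. by exists (GRing.Const c). Qed.

Lemma env_term_add V W : env_term V -> env_term W -> env_term (fun e => V e + W e).
Proof.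
move=> [t rt Ht] [u ru Hu]; exists (GRing.Add t u) => /=; first by rewrite rt.
by move=> e; rewrite Ht Hu.
Qed.

Lemma env_term_mul V W : env_term V -> env_term W -> env_term (fun e => V e * W e).
Proof.
move=> [t rt Ht] [u ru Hu]; exists (GRing.Mul t u) => /=; first by rewrite rt.
by move=> e; rewrite Ht Hu.
Qed.

Lemma env_term_opp V : env_term V -> env_term (fun e => - V e).
Proof. by move=> [t rt Ht]; exists (GRing.Opp t) => //= e; rewrite Ht. Qed.

Lemma env_term_exp V k : env_term V -> env_term (fun e => V e ^+ k).
Proof. by move=> [t rt Ht]; exists (GRing.Exp t k) => //= e; rewrite Ht. Qed.

Lemma env_term_ext V W : V =1 W -> env_term V -> env_term W.
Proof. by move=> E [t rt Ht]; exists t => // e; rewrite Ht E. Qed.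

Lemma env_term_sum (I : Type) (r : seq I) (V : I -> seq R -> R) :
  (forall i, env_term (V i)) -> env_term (fun e => \sum_(i <- r) V i e).
Proof.
move=> H; elim: r => [|i r IH].
  by apply: env_term_ext (env_term_cst 0) => e; rewrite big_nil.
by apply: env_term_ext (env_term_add (H i) IH) => e; rewrite big_cons.
Qed.

Lemma env_term_prod (I : Type) (r : seq I) (V : I -> seq R -> R) :
  (forall i, env_term (V i)) -> env_term (fun e => \prod_(i <- r) V i e).
Proof.
move=> H; elim: r => [|i r IH].
  by apply: env_term_ext (env_term_cst 1) => e; rewrite big_nil.
by apply: env_term_ext (env_term_mul (H i) IH) => e; rewrite big_cons.
Qed.

Lemma env_term_meval n (P : {mpoly R[n]}) (k : nat) :
  env_term (fun e => P.@[fun i => e`_(k + i)%N]).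
Proof.
pose W (e : seq R) := \sum_(a <- msupp P) P@_a * \prod_(i < n) e`_(k + i)%N ^+ a i.
refine (env_term_ext (V := W) _ _).
  by move=> e; rewrite mevalE.
apply: env_term_sum => a; apply: env_term_mul; first exact: env_term_cst.
by apply: env_term_prod => i; apply: env_term_exp; apply: env_term_nth.
Qed.

Lemma definable_le k V W : env_term V -> env_term W ->
  definable k (fun e => V e <= W e).
Proof.
move=> [t rt Ht] [u ru Hu]; exists (ord.Le t u) => /=; first by rewrite rt.
by move=> e _; rewrite Ht Hu.
Qed.

End Definability.

(** * The Lojasiewicz inequality *)

Section Lojasiewicz.
Variables (R : realType) (n : nat).

Lemma continuous_big_sum (I : Type) (r : seq I) (F : I -> 'rV[R]_n -> R) :
  (forall i, continuous (F i)) -> continuous (fun x => \sum_(i <- r) F i x).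
Proof.
move=> H; elim: r => [|i r IH].
  by under eq_fun do rewrite big_nil; move=> x; apply: cst_continuous.
under eq_fun do rewrite big_cons.
by move=> x; apply: continuousD; [apply: H|apply: IH].
Qed.

Lemma continuous_meval (P : {mpoly R[n]}) :
  continuous (fun x : 'rV[R]_n => P.@[x 0]).
Proof.
have prodc (I : Type) (r : seq I) (F : I -> 'rV[R]_n -> R) :
    (forall i, continuous (F i)) -> continuous (fun x => \prod_(i <- r) F i x).
  move=> H; elim: r => [|i r IH].
    by under eq_fun do rewrite big_nil; move=> x; apply: cst_continuous.
  under eq_fun do rewrite big_cons.
  by move=> x; apply: continuousM; [apply: H|apply: IH].
under eq_fun do rewrite mevalE.
apply: continuous_big_sum => a x; apply: continuousM; first exact: cst_continuous.
apply: prodc => i {}x; apply: 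
  (@continuous_comp _ _ _ (fun y : 'rV[R]_n => y 0 i) (fun z : R => z ^+ a i)).
  exact: coord_continuous.
exact: exprn_continuous.
Qed.

Lemma closed_semialg s (g : 'I_s -> {mpoly R[n]}) : closed (semialg g).
Proof.
have -> : semialg g = \bigcap_(i in [set: 'I_s]) [set x | 0 <= (g i).@[x 0]].
  by apply/seteqP; split=> x /= H i => [_|]; apply: H.
apply: closed_bigI => i _.
apply: (@closed_comp _ _ (fun x : 'rV[R]_n => (g i).@[x 0]) [set y : R | 0 <= y]).
  by move=> x _; apply: continuous_meval.
exact: closed_ge.
Qed.

Definition sqdist (x y : 'rV[R]_n) : R := \sum_i (x 0 i - y 0 i) ^+ 2.

(** The condition |x - y| >= 1/b is squared and cleared of denominators to make it polynomial in all
    variables, b included. *)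
Definition far_point s q (g : 'I_s -> {mpoly R[n]}) (t : 'I_q -> {mpoly R[n]})
    (b r : R) (x : 'rV[R]_n) : Prop :=
  [/\ semialg t x, forall j, 0 <= (g j).@[x 0] + r &
      forall y, semialg g y -> 1 <= b ^+ 2 * sqdist x y].

Variables (s q : nat) (g : 'I_s -> {mpoly R[n]}) (t : 'I_q -> {mpoly R[n]}).

Lemma far_point_formula : exists2 f : ord.formula R, ord.rformula f &
  forall b r, ord.holds [:: b; r] f <-> exists x, far_point g t b r x.
Proof.
pose row (u : seq R) : 'rV[R]_n := \row_i u`_i.
pose unrow (x : 'rV[R]_n) : seq R := [seq x 0 i | i <- enum 'I_n].
have rowK x : row (unrow x) = x.
  apply/rowP => i; rewrite mxE (nth_map i) ?size_enum_ord //.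
  by rewrite nth_ord_enum.
have sz x : size (unrow x) = n by rewrite size_map size_enum_ord.
(* Layout of the environment: b, r, the n coordinates of x, then the n coordinates of y. *)
pose P (e : seq R) := (forall j, 0 <= (g j).@[fun i => e`_(2 + n + i)%N]) ->
  1 <= e`_0 ^+ 2 * \sum_(i < n) (e`_(2 + i)%N - e`_(2 + n + i)%N) ^+ 2.
have HP : definable (2 + n + n) P.
  apply: definable_imply.
    apply: definable_all => j; apply: definable_le; first exact: env_term_cst.
    exact: env_term_meval.
  apply: definable_le; first exact: env_term_cst.
  apply: env_term_mul; first by apply: env_term_exp; apply: env_term_nth.
  apply: env_term_sum => i; apply: env_term_exp.
  by apply: env_term_add; [|apply: env_term_opp]; apply: env_term_nth.
pose Q (e : seq R) := (forall j, 0 <= (t j).@[fun i => e`_(2 + i)%N]) /\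
  ((forall j, 0 <= (g j).@[fun i => e`_(2 + i)%N] + e`_1) /\
   forall u, size u = n -> P (e ++ u)).
have HQ : definable (2 + n) Q.
  apply: definable_and.
    apply: definable_all => j; apply: definable_le; first exact: env_term_cst.
    exact: env_term_meval.
  apply: definable_and; last exact: definable_forall.
  apply: definable_all => j; apply: definable_le; first exact: env_term_cst.
  by apply: env_term_add; [exact: env_term_meval|exact: env_term_nth].
have [f rf Hf] := definable_exists HQ; exists f => // b r; rewrite Hf //.
have nth1 u (i : 'I_n) v : size u = n -> ([:: b, r & u] ++ v)`_(2 + i)%N = u`_i.
  by move=> un; rewrite /= nth_cat un ltn_ord.
have nth2 u (i : 'I_n) v : size u = n -> ([:: b, r & u] ++ v)`_(2 + n + i)%N = v`_i.
  by move=> un; rewrite /= nth_cat un ltnNge leq_addr /= addKn.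
have ev u (h : {mpoly R[n]}) : h.@[row u 0] = h.@[fun i => u`_i].
  by apply: mpoly.meval_eq => i; rewrite mxE.
have ev1 u v (h : {mpoly R[n]}) : size u = n ->
    h.@[fun i => ([:: b, r & u] ++ v)`_(2 + i)%N] = h.@[row u 0].
  by move=> un; rewrite ev; apply: mpoly.meval_eq => i; rewrite nth1.
have ev2 u v (h : {mpoly R[n]}) : size u = n ->
    h.@[fun i => ([:: b, r & u] ++ v)`_(2 + n + i)%N] = h.@[row v 0].
  by move=> un; rewrite ev; apply: mpoly.meval_eq => i; rewrite nth2.
have PE u v : size u = n -> P ([:: b, r & u] ++ v) <->
    (semialg g (row v) -> 1 <= b ^+ 2 * sqdist (row u) (row v)).
  move=> un; rewrite /P /sqdist.
  under eq_bigr do rewrite nth1 // nth2 //.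
  under [X in _ <-> (_ -> 1 <= _ * X)]eq_bigr do rewrite !mxE.
  by split=> H gv; apply: H => j; have := gv j; rewrite ev2.
have QE u : size u = n -> Q [:: b, r & u] <-> far_point g t b r (row u).
  move=> un; rewrite /Q -[[:: b, r & u]]cats0.
  split=> [[H1 [H2 H3]]|[H1 H2 H3]].
    split=> [j|j|y gy]; [by have := H1 j; rewrite ev1|by have := H2 j; rewrite ev1|].
    have := H3 (unrow y) (sz y); rewrite cats0 PE // rowK; exact.
  split; first by move=> j; rewrite ev1.
  split; first by move=> j; rewrite ev1.
  move=> v vn; rewrite cats0 PE // => gv; exact: H3.
split=> [[u un]|[x Hx]]; first by rewrite /= QE // => H; exists (row u).
by exists (unrow x) => //; rewrite QE // rowK.
Qed.

(** The points of the bounded set [semialg t] at distance at least 1/b from [semialg g] form a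
    compact set, on which the total violation of the constraints g_j >= 0 has a positive minimum.
    How [r0] depends on b remains unknown. *)
Lemma far_point_small (B : R) (b : nat) : (0 < b)%N ->
  (forall x, semialg t x -> forall i, `|x 0 i| <= B) ->
  exists2 r0 : R, 0 < r0 & forall r x, r <= r0 -> ~ far_point g t b%:R r x.
Proof.
move=> b0 HB.
pose Z := semialg t `&` \bigcap_(y in semialg g) [set x | 1 <= b%:R ^+ 2 * sqdist x y].
have Zc : compact Z.
  apply: (@subclosed_compact _ _ [set x : 'rV[R]_n | forall i, `[- B, B]%classic (x ord0 i)]).
  - apply: closedI; first exact: closed_semialg.
    apply: closed_bigI => y _.
    pose h : {mpoly R[n]} := (b%:R ^+ 2) *: \sum_i ('X_i - (y 0 i)%:MP) ^+ 2.
    have hE (x : 'rV[R]_n) : h.@[x 0] = b%:R ^+ 2 * sqdist x y.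
      rewrite /h mevalZ meval_sum; congr (_ * _); apply: eq_bigr => i _.
      by rewrite rmorphXn rmorphB /= mevalXU mevalC.
    apply: (@closed_comp _ _ (fun x : 'rV[R]_n => b%:R ^+ 2 * sqdist x y) [set z : R | 1 <= z]).
      move=> x _; under eq_fun do rewrite -hE; exact: continuous_meval.
    exact: closed_ge.
  - apply: (@rV_compact R n (fun=> `[- B, B]%classic)) => i; exact: segment_compact.
  - move=> x [tx _] i; rewrite /= in_itv /= -ler_norml; exact: HB.
have [Z0|/set0P Zn] := eqVneq Z set0.
  exists 1 => // r x _ [H1 H2 H3].
  suff : Z x by rewrite Z0.
  by split=> // y gy; apply: H3.
pose G (x : 'rV[R]_n) := \sum_(j < s) Num.max 0 (- (g j).@[x 0]).
have Gc : continuous G.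
  apply: continuous_big_sum => j x.
  apply: (@continuous_max _ _ (fun=> 0) (fun x : 'rV[R]_n => - (g j).@[x 0])).
    exact: cst_continuous.
  by apply: continuousN; apply: continuous_meval.
have [z zZ zmin] := EVT_min_rV Zn Zc (continuous_subspaceT Gc).
have max0 (y : R) : 0 <= Num.max 0 y by rewrite le_max lexx.
have Gz : 0 < G z.
  rewrite lt0r sumr_ge0 // andbT; apply/negP => /eqP G0.
  have gz : semialg g z.
    move=> j; have /eqP := G0; rewrite psumr_eq0 // => /allP/(_ j (mem_index_enum _)) /=.
    move=> /eqP E; have : - (g j).@[z 0] <= 0 by rewrite -E le_max lexx orbT.
    by rewrite oppr_le0.
  move: zZ; rewrite inE => -[_ /(_ z gz)] /=.
  rewrite /sqdist big1 ?mulr0 ?ler10 // => i _; by rewrite subrr expr0n.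
(* A far point for r has total violation at most s r; dividing by s + 1 keeps this strictly below
   the minimum. *)
exists (G z / (s%:R + 1)); first by rewrite divr_gt0 // -[s%:R + 1]natr1 ltr0n.
move=> r x rr0 [H1 H2 H3].
have Zx : x \in Z by rewrite inE; split=> // y gy; apply: H3.
have := zmin x Zx; apply/negP; rewrite -ltNge.
have s1 : 0 < s%:R + 1 :> R by rewrite natr1 ltr0n.
apply: (@le_lt_trans _ _ (\sum_(j < s) (G z / (s%:R + 1)))).
  apply: ler_sum => j _; rewrite ge_max (divr_ge0 (ltW Gz) (ltW s1)) /=.
  by apply: le_trans rr0; have := H2 j; lra.
rewrite sumr_const card_ord -[_ *+ s]mulr_natl mulrA ltr_pdivrMr // mulrC.
by rewrite ltr_pM2l // ltrDl.
Qed.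

(** The existence of a far point is a first-order condition on b and r. By compactness it fails for
    small r, at an uncontrolled rate in b; by stability its truth value is the same for all positive
    r up to an explicit inverse power of b, so it already fails there. *)
Lemma lojasiewicz (B : R) :
  (forall x, semialg t x -> forall i, `|x 0 i| <= B) ->
  exists2 K : nat, (0 < K)%N & forall b x, (0 < b)%N -> semialg t x ->
    (forall j, - (K%:R * b%:R ^+ K)^-1 <= (g j).@[x 0]) ->
    exists2 y, semialg g y & \sum_i `|x 0 i - y 0 i| <= b%:R^-1.
Proof.
move=> HB; have [f rf Hf] := far_point_formula.
have [K HK] := stable_holds rf.
(* The point is sought at distance 1/b' with b' = k b: k >= K puts b' above the threshold of
   stability for every b > 0, and k >= n lets n coordinate errors of at most 1/b' add up to at most
   1/b. [M] absorbs the constant K k^K that appears in K b'^K. *)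
pose k := (K + n).+1; pose M := (k ^ k.+1)%N.
have k0 : (0 < k)%N by [].
have M0 : (0 < M)%N by rewrite expn_gt0.
exists M => // b x b0 tx Hg; apply: contrapT => Hno.
pose b' := (k * b)%N; have b'0 : (0 < b')%N by rewrite muln_gt0.
have [r0 r00 Hr0] := far_point_small b'0 HB.
pose r : R := (M%:R * b%:R ^+ M)^-1.
have rM0 : 0 < M%:R * b%:R ^+ M :> R by rewrite mulr_gt0 ?exprn_gt0 ?ltr0n.
have rp : 0 < r by rewrite invr_gt0.
have Kk : (K <= k)%N by rewrite /k; lia.
have Hr : r * (K%:R * b'%:R ^+ K) <= 1.
  rewrite mulrC ler_pdivrMr // mul1r -!natrX -!natrM ler_nat /b' expnMn mulnA.
  apply: leq_mul; last by rewrite leq_pexp2l // /M (leq_trans Kk) // -{1}(expn1 k) leq_pexp2l.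
  by rewrite /M expnS leq_mul // leq_pexp2l.
pose r' := Num.min r r0.
have r'0 : 0 < r' by rewrite lt_min rp.
have Hr' : r' * (K%:R * b'%:R ^+ K) <= 1.
  by apply: le_trans Hr; rewrite ler_wpM2r ?mulr_ge0 ?exprn_ge0 // ge_min lexx.
have := HK b' r r' _ b'0 rp Hr r'0 Hr'.
rewrite (leq_trans Kk) ?leq_pmulr // => /(_ isT) E.
have : `[< ord.holds [:: b'%:R; r] f >].
  apply/asboolP/Hf; exists x; split=> // [j|y gy].
    by rewrite addrC -lerBlDl sub0r; apply: Hg.
  rewrite leNgt; apply/negP => Hlt; apply: Hno; exists y => //.
  have b'R : 0 < b'%:R :> R by rewrite ltr0n.
  have Hi i : `|x 0 i - y 0 i| <= b'%:R^-1.
    rewrite -[leRHS]mul1r ler_pdivlMr //.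
    have : (`|x 0 i - y 0 i| * b'%:R) ^+ 2 <= 1.
      rewrite exprMn real_normK ?num_real // mulrC; apply: le_trans (ltW Hlt).
      rewrite ler_wpM2l ?exprn_ge0 // /sqdist (bigD1 i) //= lerDl.
      by apply: sumr_ge0 => j _; apply: sqr_ge0.
    by rewrite expr_le1 // mulr_ge0.
  apply: (le_trans (ler_sum _ (fun i _ => Hi i))).
  rewrite sumr_const card_ord -[_ *+ n]mulr_natl ler_pdivrMr // ler_pdivlMl ?ltr0n //.
  rewrite -natrM ler_nat /b' /k.
  by rewrite [leqLHS]mulnC leq_mul // leqW // leq_addl.
rewrite E => /asboolP/Hf[z]; apply: Hr0.
by rewrite ge_min lexx orbT.
Qed.

End Lojasiewicz.

(** * Sums of squares and degrees *)

Section UnivariateSos.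
Variable R : realType.
Implicit Types p q : {poly R}.

Lemma continuous_horner_poly p : continuous (fun y : R => p.[y]).
Proof.
elim/poly_ind: p => [|p c IH].
  by under eq_fun do rewrite horner0; move=> x; apply: cst_continuous.
under eq_fun do rewrite hornerMXaddC.
move=> x; apply: (@continuousD _ _ _ (fun y : R => p.[y] * y) (fun=> c)).
  by apply: (@continuousM _ _ (fun y : R => p.[y]) id) => //; apply: IH.
exact: cst_continuous.
Qed.

Lemma nonneg_poly_coercive p m : (forall y, 0 <= p.[y]) -> (1 < size p)%N ->
  exists B : R, forall y, B <= y -> m <= p.[y].
Proof.
move=> p0 sp; apply: polyrcf.poly_lim_infty => //.
rewrite lt0r lead_coef_eq0 -size_poly_gt0 (ltn_trans _ sp) //= leNgt.
apply/negP => lp; have := @polyrcf.poly_lim_infty _ (- p) 1.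
rewrite lead_coefN oppr_gt0 size_polyN => /(_ lp sp) [B /(_ B (lexx B))].
by rewrite hornerN leNgt => /negP; apply; rewrite (le_lt_trans _ ltr01) // oppr_le0.
Qed.

Lemma nonneg_poly_min p : (forall y, 0 <= p.[y]) ->
  exists y0, forall y, p.[y0] <= p.[y].
Proof.
move=> p0; have [sp|sp] := leqP (size p) 1.
  by rewrite (size1_polyC sp); exists 0 => y; rewrite !hornerC.
have [B HB] := nonneg_poly_coercive p.[0] p0 sp.
have [B' HB'] : exists B', forall y, B' <= y -> p.[0] <= (p \Po - 'X).[y].
  apply: nonneg_poly_coercive => [y|]; first by rewrite horner_comp.
  by rewrite size_comp_poly2 // size_polyN size_polyX.
pose C := Num.max 0 (Num.max B B').
have C0 : 0 <= C by rewrite le_max lexx.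
have [||y0 _ Hy0] := @EVT_min R (fun y => p.[y]) (- C) C.
- by rewrite ge0_cp.
- by apply: continuous_subspaceT; apply: continuous_horner_poly.
exists y0 => y; have p00 : p.[y0] <= p.[0] by apply: Hy0; rewrite in_itv /= oppr_le0 C0.
have [yC|yC] := leP `|y| C; first by apply: Hy0; rewrite in_itv /= -ler_norml.
apply: (le_trans p00); move: yC; rewrite ltr_normr => /orP[yC|yC].
  by apply: HB; apply: le_trans (ltW yC); rewrite !le_max lexx orbT.
have := HB' (- y); rewrite horner_comp !hornerE opprK; apply.
by apply: le_trans (ltW yC); rewrite !le_max lexx !orbT.
Qed.

(** If the cofactor of X - y0 did not vanish at y0, then p would change sign there. *)
Lemma nonneg_poly_double_root p y0 : (forall y, 0 <= p.[y]) -> root p y0 ->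
  exists q, p = ('X - y0%:P) ^+ 2 * q.
Proof.
move=> p0 /factor_theorem[q pE].
suff /factor_theorem[q' qE] : root q y0.
  by exists q'; rewrite pE qE -mulrA -expr2 mulrC.
apply/rootP/eqP; case: (ltrgt0P q.[y0]) => // qy.
- have [d d0 Hd] := polyrcf.poly_cont y0 q qy.
  have := Hd (y0 - d / 2); rewrite addrAC subrr add0r normrN gtr0_norm ?divr_gt0 //.
  have dd : d / 2 < d by rewrite ltr_pdivrMr // ltr_pMr // ltr1n.
  move=> /(_ dd); rewrite ltr_norml => /andP[H _].
  have := p0 (y0 - d / 2); rewrite pE hornerM !hornerE.
  have -> : y0 - d / 2 - y0 = - (d / 2) by ring.
  rewrite mulrN oppr_ge0 pmulr_lle0 ?divr_gt0 // leNgt => /negP []; lra.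
- have nq : 0 < - q.[y0] by rewrite oppr_gt0.
  have [d d0 Hd] := polyrcf.poly_cont y0 q nq.
  have := Hd (y0 + d / 2); rewrite addrAC subrr add0r gtr0_norm ?divr_gt0 //.
  have dd : d / 2 < d by rewrite ltr_pdivrMr // ltr_pMr // ltr1n.
  move=> /(_ dd); rewrite ltr_norml => /andP[_ H].
  have := p0 (y0 + d / 2); rewrite pE hornerM !hornerE.
  have -> : y0 + d / 2 - y0 = d / 2 by ring.
  rewrite pmulr_lge0 ?divr_gt0 // leNgt => /negP []; lra.
Qed.

Lemma is_sos0 (A : pzRingType) : is_sos (0 : A).
Proof. by exists [::]; rewrite big_nil. Qed.

Lemma is_sos_sqr (A : pzRingType) (a : A) : is_sos (a ^+ 2).
Proof. by exists [:: a]; rewrite big_seq1. Qed.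

Lemma is_sosD (A : pzRingType) (a b : A) : is_sos a -> is_sos b -> is_sos (a + b).
Proof. by move=> [t ->] [u ->]; exists (t ++ u); rewrite big_cat. Qed.

Lemma is_sosM (A : comPzRingType) (a b : A) : is_sos a -> is_sos b -> is_sos (a * b).
Proof.
move=> [t ->] [u ->]; exists [seq x * y | x <- t, y <- u].
rewrite big_allpairs_dep mulr_suml; apply: eq_bigr => x _.
by rewrite mulr_sumr; apply: eq_bigr => y _; rewrite exprMn.
Qed.

Lemma is_sos_sum (A : pzRingType) (I : Type) (r : seq I) (P : pred I) (F : I -> A) :
  (forall i, P i -> is_sos (F i)) -> is_sos (\sum_(i <- r | P i) F i).
Proof.
by move=> H; elim/big_ind: _ => //; [apply: is_sos0|move=> x y; apply: is_sosD].
Qed.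

Lemma is_sos_morph (A B : pzRingType) (h : {rmorphism A -> B}) (a : A) :
  is_sos a -> is_sos (h a).
Proof.
move=> [t ->]; exists (map h t); rewrite big_map rmorph_sum /=.
by apply: eq_bigr => x _; rewrite rmorphXn.
Qed.

Lemma is_sos_polyC (c : R) : 0 <= c -> is_sos c%:P.
Proof.
by move=> c0; rewrite -(sqr_sqrtr c0) polyC_exp; apply: is_sos_sqr.
Qed.

(** Subtracting the minimum value creates a double root; the cofactor of its square is again
    nonnegative and has smaller degree, so that no complex roots are involved. *)
Lemma nonneg_poly_sos p : (forall y, 0 <= p.[y]) -> is_sos p.
Proof.
have [k] := ubnP (size p); elim: k p => // k IH p sp p0.
have [sp1|sp1] := leqP (size p) 1.
  rewrite (size1_polyC sp1); apply: is_sos_polyC.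
  by have := p0 0; rewrite (size1_polyC sp1) hornerC coefC eqxx.
have [y0 Hy0] := nonneg_poly_min p0.
have r0 : forall y, 0 <= (p - p.[y0]%:P).[y].
  by move=> y; rewrite hornerD hornerN hornerC subr_ge0.
have rr : root (p - p.[y0]%:P) y0 by rewrite rootE hornerD hornerN hornerC subrr.
have [q qE] := nonneg_poly_double_root r0 rr.
have -> : p = ('X - y0%:P) ^+ 2 * q + p.[y0]%:P by rewrite -qE subrK.
apply: is_sosD; last exact: is_sos_polyC.
apply: is_sosM; first exact: is_sos_sqr.
have sq : size (p - p.[y0]%:P) = size p.
  by rewrite size_polyDl // size_polyN (leq_ltn_trans (size_polyC_leq1 _)).
have q0 : q != 0.
  by apply/eqP => q0; move: sq; rewrite qE q0 mulr0 size_poly0 => e; rewrite -e in sp1.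
have X0 : ('X - y0%:P) ^+ 2 != 0 :> {poly R} by rewrite expf_neq0 // polyXsubC_eq0.
apply: IH => [|y].
  by move: sq sp; rewrite qE size_mul // size_exp_XsubC /= => <-; rewrite add2n ltnS => /ltnW.
have nonneg_off z : z != y0 -> 0 <= q.[z].
  move=> zy; have := r0 z; rewrite qE hornerM horner_exp hornerXsubC pmulr_rge0 //.
  by rewrite exprn_even_gt0 //= subr_eq0.
have [->|/nonneg_off //] := eqVneq y y0.
(* At y0 itself the sign of the cofactor follows by continuity from nearby points. *)
rewrite leNgt; apply/negP => qy; have nq : 0 < - q.[y0] by rewrite oppr_gt0.
have [d d0 Hd] := polyrcf.poly_cont y0 q nq.
have := Hd (y0 + d / 2); rewrite addrAC subrr add0r gtr0_norm ?divr_gt0 //.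
have dd : d / 2 < d by rewrite ltr_pdivrMr // ltr_pMr // ltr1n.
move=> /(_ dd); rewrite ltr_norml => /andP[_ H].
have := nonneg_off (y0 + d / 2); rewrite -subr_eq0 addrAC subrr add0r.
by rewrite gt_eqF ?divr_gt0 // => /(_ isT); lra.
Qed.

Lemma positive_poly_odd_size p : (forall y, 0 < p.[y]) -> odd (size p).
Proof.
move=> p0; apply: contraT => /polyrcf.odd_poly_root[x /rootP px].
by have := p0 x; rewrite px ltxx.
Qed.

End UnivariateSos.

(** * Bounds on the total degree *)

Section TotalDegree.
Variables (R : realType) (n : nat).
Implicit Types f h : {poly {mpoly R[n]}}.

(** Formulated on supports, so that cancellations and zero terms need no case distinction in sums
    and products. *)
Definition tdeg_le (k : nat) f : Prop :=
  forall i a, a \in msupp f`_i -> (mdeg a + i <= k)%N.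

Lemma degXY_le k f : tdeg_le k f -> (degXY f <= k)%N.
Proof.
move=> H; apply/bigmax_leqP => i fi.
have := mlead_supp fi => /H; have := mlead_deg fi; lia.
Qed.

Lemma tdeg_leW k l f : (k <= l)%N -> tdeg_le k f -> tdeg_le l f.
Proof. by move=> kl H i a /H /leq_trans; apply. Qed.

Lemma tdeg_le0 k : tdeg_le k 0.
Proof. by move=> i a; rewrite coef0 msupp0. Qed.

Lemma tdeg_leD k f h : tdeg_le k f -> tdeg_le k h -> tdeg_le k (f + h).
Proof.
move=> Hf Hh i a; rewrite coefD => /msuppD_le; rewrite mem_cat => /orP[/Hf|/Hh] //.
Qed.

Lemma tdeg_le_sum k (I : Type) (r : seq I) (P : pred I) (F : I -> {poly {mpoly R[n]}}) :
  (forall i, P i -> tdeg_le k (F i)) -> tdeg_le k (\sum_(i <- r | P i) F i).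
Proof.
by move=> H; elim/big_ind: _ => //; [apply: tdeg_le0|move=> *; apply: tdeg_leD].
Qed.

Lemma msupp_sum_sub (I : eqType) (r : seq I) (P : pred I) (F : I -> {mpoly R[n]}) a :
  a \in msupp (\sum_(i <- r | P i) F i) -> exists2 i, P i & a \in msupp (F i).
Proof.
elim/big_rec: _ => [|i p Pi IH]; first by rewrite msupp0.
by move=> /msuppD_le; rewrite mem_cat => /orP[H|/IH //]; exists i.
Qed.

Lemma tdeg_leM k l f h : tdeg_le k f -> tdeg_le l h -> tdeg_le (k + l) (f * h).
Proof.
move=> Hf Hh i a; rewrite coefM => /msupp_sum_sub[j _ /msuppM_le].
move=> /allpairsP[[b c] /= [/Hf Hb /Hh Hc ->]].
rewrite mdegD; have := ltn_ord j; lia.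
Qed.

Lemma tdeg_le1 k : tdeg_le k 1.
Proof.
move=> i a; rewrite coefC; case: eqP => [->|_]; last by rewrite msupp0.
by rewrite msupp1 inE => /eqP ->; rewrite mdeg0.
Qed.

Lemma tdeg_leX k f j : tdeg_le k f -> tdeg_le (k * j) (f ^+ j).
Proof.
move=> H; elim: j => [|j IH]; first by rewrite expr0; apply: tdeg_le1.
by rewrite exprS mulnS; apply: tdeg_leM.
Qed.

Lemma tdeg_le_polyC k (P : {mpoly R[n]}) : (msize P <= k.+1)%N -> tdeg_le k P%:P.
Proof.
move=> Pk i a; rewrite coefC; case: eqP => [->|_]; last by rewrite msupp0.
move=> /msize_mdeg_lt; lia.
Qed.

Lemma tdeg_le_map k (b : {poly R}) : (size b <= k.+1)%N ->
  tdeg_le k (map_poly (@mpolyC n R) b).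
Proof.
move=> bk i a; rewrite coef_map /= msuppC; case: eqP => //= /eqP bi.
rewrite inE => /eqP ->; rewrite mdeg0 add0n -ltnS; apply: leq_trans bk.
by rewrite ltnNge; apply: contra bi => /leq_sizeP ->.
Qed.

Lemma tdeg_leZ k (c : R) f : tdeg_le k f -> tdeg_le k ((c%:MP)%:P * f).
Proof.
move=> H; rewrite -[k]add0n; apply: tdeg_leM H.
by apply: tdeg_le_polyC; rewrite mmeasureC leq_b1.
Qed.

Lemma tdeg_leN k f : tdeg_le k f -> tdeg_le k (- f).
Proof. by move=> H i a; rewrite coefN (perm_mem (msuppN _)) => /H. Qed.

End TotalDegree.

Section PrincipalModule.
Variables (R : realType) (n : nat) (u : {poly {mpoly R[n]}}) (du : nat).
Hypothesis Hdu : tdeg_le du u.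

(* Membership in the quadratic module of u, with degrees.  It is closed under
   products since u ^+ 2 is a square. *)
Definition cert (k : nat) (P : {poly {mpoly R[n]}}) : Prop :=
  exists A B, [/\ is_sos A, is_sos B, tdeg_le k A, tdeg_le k B & P = A + B * u].

Lemma cert_sos k P : is_sos P -> tdeg_le k P -> cert k P.
Proof.
move=> sP dP; exists P, 0; split=> //; [exact: is_sos0|exact: tdeg_le0|].
by rewrite mul0r addr0.
Qed.

Lemma certD k P Q : cert k P -> cert k Q -> cert k (P + Q).
Proof.
move=> [A [B [sA sB dA dB ->]]] [A' [B' [sA' sB' dA' dB' ->]]].
exists (A + A'), (B + B'); split; try exact: is_sosD; try exact: tdeg_leD.
by ring.
Qed.

Lemma certM k l P Q : cert k P -> cert l Q -> cert (k + l + du * 2) (P * Q).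
Proof.
move=> [A [B [sA sB dA dB ->]]] [A' [B' [sA' sB' dA' dB' ->]]].
exists (A * A' + B * B' * u ^+ 2), (A * B' + B * A'); split.
- by apply: is_sosD; [|apply: is_sosM; last exact: is_sos_sqr]; exact: is_sosM.
- by apply: is_sosD; exact: is_sosM.
- apply: tdeg_leD; first by apply: (@tdeg_leW _ _ (k + l)); [lia|exact: tdeg_leM].
  by apply: tdeg_leM; [exact: tdeg_leM|exact: tdeg_leX].
- by apply: tdeg_leD; apply: (@tdeg_leW _ _ (k + l)); try lia; exact: tdeg_leM.
- by ring.
Qed.

Lemma cert_sum k (I : Type) (r : seq I) (F : I -> {poly {mpoly R[n]}}) :
  (forall i, cert k (F i)) -> cert k (\sum_(i <- r) F i).
Proof.
move=> H; elim/big_ind: _ => //; last by move=> *; apply: certD.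
by apply: cert_sos; [exact: is_sos0|exact: tdeg_le0].
Qed.

Lemma cert_prod k (I : finType) (F : I -> {poly {mpoly R[n]}}) :
  (forall i, cert k (F i)) -> cert ((k + du * 2) * #|I|) (\prod_i F i).
Proof.
move=> H; rewrite cardE -[in X in cert _ X](big_enum _ _ predT) /=.
elim: (enum _) => [|i r IH].
  rewrite big_nil; apply: cert_sos; last exact: tdeg_le1.
  by rewrite -(expr1n _ 2); apply: is_sos_sqr.
by rewrite big_cons /= (mulnS _ (size r)) addnAC; apply: certM.
Qed.

End PrincipalModule.

(** * Homogeneous parts and barycentric coordinates *)

Section HomogeneousParts.
Variables (R : realType) (n : nat).

Definition mvars (i : 'I_n) : {mpoly R[n]} := 'X_i.

Lemma multinomial_coef_gt0 (a : 'X_{1..n}) : 0 < multinomial_coef R a.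
Proof.
rewrite divr_gt0 ?ltr0n ?fact_gt0 //; apply: prodn_gt0 => i; exact: fact_gt0.
Qed.

(** This counts the words with content a by their first letter: those that begin with j are a
    proportion a_j / |a| of all, and the a_j sum to |a|. *)
Lemma multinomial_coef_rec (a : 'X_{1..n}) : (0 < mdeg a)%N ->
  multinomial_coef R a = \sum_(j | a j != 0%N) multinomial_coef R (a - U_(j))%MM.
Proof.
move=> a0; have d0 : (mdeg a)%:R != 0 :> R by rewrite pnatr_eq0 -lt0n.
rewrite (eq_bigr (fun j => multinomial_coef R a / (mdeg a)%:R * (a j)%:R)); last first.
  move=> j aj; have aE : a = (a - U_(j) + U_(j))%MM by rewrite submK // lep1mP.
  have dE : mdeg a = (mdeg (a - U_(j))).+1 by rewrite {1}aE mdegD mdeg1 addn1.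
  have pE : (\prod_i (a i)`! = a j * \prod_i ((a - U_(j))%MM i)`!)%N.
    rewrite (bigD1 j) //= [in RHS](bigD1 j) //= mnmBE mnm1E eqxx mulnA.
    congr (_ * _)%N; first by case: (a j) aj => // k _; rewrite subn1 factS.
    by apply: eq_bigr => i ij; rewrite mnmBE mnm1E eq_sym (negbTE ij) subn0.
  rewrite /multinomial_coef pE dE factS !natrM -dE.
  have p0 : (\prod_i ((a - U_(j))%MM i)`!)%:R != 0 :> R.
    by rewrite pnatr_eq0 -lt0n prodn_gt0 // => i; apply: fact_gt0.
  by field; rewrite p0 d0 pnatr_eq0.
rewrite -mulr_sumr -[LHS]mulr1 -[in RHS]mulrA; congr (_ * _).
rewrite -natr_sum (_ : \sum_(j | a j != 0%N) a j = mdeg a)%N ?mulVf //.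
rewrite mdegE [RHS](bigID (fun j => a j != 0%N)) /= [X in (_ + X)%N]big1 ?addn0 //.
by move=> j /negbNE/eqP.
Qed.

Lemma multinomial_coef0 : multinomial_coef R (0%MM : 'X_{1..n}) = 1.
Proof.
rewrite /multinomial_coef mdeg0 big1 ?divr1 // => i _; by rewrite mnm0E.
Qed.

(** The monomial X^a is the common value of [multinomial_coef R a] words, each of which receives the
    coefficient c_a. The normalisation in ||f||_bullet is thus exactly what bounds the coefficients
    of words. *)
Lemma wrep_homogeneous (L : R) k (c : 'X_{1..n} -> R) (P : {mpoly R[n]}) :
  (forall a, `|c a| <= L) ->
  (forall a, P@_a = if mdeg a == k then c a * multinomial_coef R a else 0) ->
  wrep mvars k L P.
Proof.
elim: k c P => [|k IH] c P HL HP /=.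
  exists (c 0%MM) => //; apply/mpolyP => a; rewrite HP mcoeffC mdeg_eq0.
  by case: eqP => [->|]; rewrite ?multinomial_coef0 ?mulr0.
(* F j collects the words that begin with X_j, with that letter removed: content a remains of a +
   U_j. *)
pose F j := \sum_(a : 'X_{1..n < k.+1})
  ((if mdeg a == k then c (a + U_(j))%MM * multinomial_coef R a else 0) *: 'X_[a]).
have FE j a : (F j)@_a = if mdeg a == k then c (a + U_(j))%MM * multinomial_coef R a else 0.
  rewrite /F; have [ak|ka] := ltnP (mdeg a) k.+1.
    by rewrite (mcoeff_mpoly (fun a : 'X_{1..n} =>
      if mdeg a == k then c (a + U_(j))%MM * multinomial_coef R a else 0)).
  rewrite ifN ?gtn_eqF //; apply/eqP; rewrite mcoeff_eq0; apply: contraL ka => H.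
  have [b _ Hb] := msupp_sum_sub H; rewrite -leqNgt.
  have {}Hb := msuppZ_le Hb; move: Hb; rewrite msuppX inE => /eqP ->.
  by have := bmdeg b; rewrite ltnS.
exists F => [j|]; first by apply: (IH (fun a => c (a + U_(j))%MM)).
apply/mpolyP => a; rewrite HP raddf_sum /=.
have XE j : (mvars j * F j)@_a = if a j != 0%N then (F j)@_(a - U_(j))%MM else 0.
  rewrite /mvars mulrC; case: ifPn => aj.
    by rewrite -{1}(submK (_ : U_(j) <= a)%MM) ?lep1mP // addmC mcoeffMX.
  apply/eqP; rewrite mcoeff_eq0; apply: contra aj => /msuppM_le.
  case/allpairsP => -[b b'] /= [_]; rewrite msuppX inE => /eqP -> ->.
  by rewrite mnmDE mnm1E eqxx addn1.
rewrite (eq_bigr _ (fun j _ => XE j)) -big_mkcond /=.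
have [ak|ak] := eqVneq (mdeg a) k.+1; last first.
  rewrite big1 // => j aj; rewrite FE ifN //; apply: contra ak => /eqP <-.
  by rewrite -{1}(submK (_ : U_(j) <= a)%MM) ?lep1mP // mdegD mdeg1 addn1.
rewrite multinomial_coef_rec ?ak // mulr_sumr; apply: eq_bigr => j aj.
have aE : (a - U_(j) + U_(j))%MM = a by rewrite submK // lep1mP.
by rewrite FE aE ifT // -eqSS -ak -{2}aE mdegD mdeg1 addn1.
Qed.

Lemma homogeneous_decomposition (L : R) d (P : {mpoly R[n]}) : 0 <= L ->
  (msize P <= d.+1)%N ->
  (forall a : 'X_{1..n}, (mdeg a <= d)%N -> `|P@_a / multinomial_coef R a| <= L) ->
  exists2 F : nat -> {mpoly R[n]}, forall k, wrep mvars k L (F k) &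
    P = \sum_(k < d.+1) F k.
Proof.
move=> L0 Pd HL.
(* The part of degree k is set to 0 for k > d, since [HL] covers degrees up to d while the bound is
   wanted for every k. *)
pose c (k : nat) (a : 'X_{1..n}) := if (mdeg a == k) && (k <= d)%N then P@_a else 0.
pose F (k : nat) := \sum_(a : 'X_{1..n < d.+1}) (c k a *: 'X_[a]).
have FE k a : (F k)@_a = c k a.
  rewrite /F; have [ad|da] := ltnP (mdeg a) d.+1.
    by rewrite (mcoeff_mpoly (c k)).
  have -> : c k a = 0 by rewrite /c; case: eqP => //= <-; rewrite leqNgt da.
  apply/eqP; rewrite mcoeff_eq0; apply: contraL da => H.
  have [b _ Hb] := msupp_sum_sub H; rewrite -leqNgt.
  have {}Hb := msuppZ_le Hb; move: Hb; rewrite msuppX inE => /eqP ->.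
  by have := bmdeg b; rewrite ltnS.
exists F => [k|].
  apply: (wrep_homogeneous (c := fun a => c k a / multinomial_coef R a)) => a.
    rewrite /c; case: ifP => [/andP[/eqP <- ad]|_]; first exact: HL.
    by rewrite mul0r normr0.
  have m0 : multinomial_coef R a != 0 by rewrite gt_eqF ?multinomial_coef_gt0.
  by rewrite FE divfK // /c; case: eqP.
apply/mpolyP => a; rewrite raddf_sum /= (eq_bigr (fun k : 'I_d.+1 => c k a)); last by [].
have [ad|da] := ltnP (mdeg a) d.+1.
  rewrite (bigD1 (Ordinal ad)) //= /c eqxx -ltnS ad /= big1 ?addr0 // => k.
  move=> H; rewrite ifN // negb_and; apply/orP; left.
  by apply: contra H => /eqP e; apply/eqP/val_inj; rewrite /= e.
rewrite memN_msupp_eq0 ?msize_mdeg_ge ?(leq_trans Pd) // big1 // => k _.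
rewrite /c ifN // negb_and; apply/orP; left; apply: contraL da => /eqP ->.
by rewrite -ltnNge.
Qed.

End HomogeneousParts.

Section Barycentric.
Variables (R : realType) (n : nat) (rho : R).
Hypotheses (n0 : (0 < n)%N) (rho1 : 1 <= rho).

(** The sum of the n forms X_i + rho and the n forms rho - X_i, which normalises the coordinates to
    sum 1. *)
Definition bary_scale : R := 2 * n%:R * rho.

(* Barycentric coordinates of the simplex x_i >= -rho, sum_i x_i <= n rho. *)
Definition bary (j : 'I_n.+1) : {mpoly R[n]} :=
  if unlift ord0 j is Some i then bary_scale^-1 *: ('X_i + rho%:MP)
  else bary_scale^-1 *: \sum_(i < n) (rho%:MP - 'X_i).

Lemma bary_scale_gt0 : 0 < bary_scale.
Proof. by rewrite !mulr_gt0 ?ltr0n // (lt_le_trans ltr01). Qed.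

Lemma rho_le_bary_scale : rho <= bary_scale.
Proof.
have r0 : 0 < rho by apply: lt_le_trans rho1.
have n1 : 1 <= n%:R :> R by rewrite ler1n.
by rewrite /bary_scale ler_peMl 1?ltW //; lra.
Qed.

Lemma bary_ord0 : bary ord0 = bary_scale^-1 *: \sum_(i < n) (rho%:MP - 'X_i).
Proof. by rewrite /bary unlift_none. Qed.

Lemma bary_lift i : bary (lift ord0 i) = bary_scale^-1 *: ('X_i + rho%:MP).
Proof. by rewrite /bary liftK. Qed.

Lemma bary_sum : \sum_j bary j = 1.
Proof.
rewrite big_ord_recl bary_ord0 (eq_bigr _ (fun i _ => bary_lift i)).
rewrite -scaler_sumr -scalerDr -big_split /=.
rewrite (eq_bigr (fun=> (2 * rho)%:MP)); last first.
  by move=> i _; rewrite mpolyCM mpolyC_nat; ring.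
rewrite sumr_const card_ord -mpolyCMn -mul_mpolyC -mpolyCM -[(2 * rho) *+ n]mulr_natr.
rewrite /bary_scale mulrAC mulVf ?mpolyC1 // gt_eqF //.
by have := bary_scale_gt0; rewrite /bary_scale mulrAC.
Qed.

Lemma meval_bary0 (x : 'I_n -> R) :
  (bary ord0).@[x] = bary_scale^-1 * \sum_i (rho - x i).
Proof.
rewrite bary_ord0 mevalZ meval_sum; congr (_ * _); apply: eq_bigr => i _.
by rewrite rmorphB /= mevalC mevalXU.
Qed.

Lemma meval_baryS (x : 'I_n -> R) i :
  (bary (lift ord0 i)).@[x] = bary_scale^-1 * (x i + rho).
Proof. by rewrite bary_lift mevalZ rmorphD /= mevalC mevalXU. Qed.

Lemma bary_point (c : 'I_n.+1 -> R) : \sum_j c j = 1 ->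
  exists x : 'rV[R]_n, forall j, (bary j).@[x 0] = c j.
Proof.
move=> c1; exists (\row_i (bary_scale * c (lift ord0 i) - rho)) => j.
have k0 : bary_scale != 0 by rewrite gt_eqF ?bary_scale_gt0.
case: (unliftP ord0 j) => [i|] ->.
  by rewrite meval_baryS mxE subrK mulKf.
rewrite meval_bary0 (eq_bigr (fun i => 2 * rho - bary_scale * c (lift ord0 i))); last first.
  by move=> i _; rewrite mxE; ring.
rewrite sumrB sumr_const card_ord -mulr_sumr.
have -> : c ord0 = 1 - \sum_(i < n) c (lift ord0 i) by rewrite -c1 big_ord_recl addrK.
rewrite mulrBr mulKf //; congr (_ - _).
by rewrite -[_ *+ n]mulr_natr [2 * rho * _]mulrAC -/bary_scale mulVf.
Qed.

Lemma bary_bounded (x : 'rV[R]_n) : semialg bary x -> forall i, `|x 0 i| <= bary_scale.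
Proof.
move=> Hx i; have k0 := bary_scale_gt0.
have r0 : 0 <= rho by apply: le_trans rho1.
have lo l : - rho <= x 0 l.
  have := Hx (lift ord0 l); rewrite meval_baryS pmulr_rge0 ?invr_gt0 //; lra.
have hi : \sum_i (rho - x 0 i) >= 0.
  by have := Hx ord0; rewrite meval_bary0 pmulr_rge0 ?invr_gt0.
have rk := rho_le_bary_scale.
rewrite ler_norml; apply/andP; split; first by apply: le_trans (lo i); rewrite lerN2.
move: hi; rewrite (bigD1 i) //=.
have : \sum_(l | l != i) (rho - x 0 l) <= \sum_(l < n | l != i) (2 * rho).
  by apply: ler_sum => l _; have := lo l; lra.
have -> : \sum_(l < n | l != i) (2 * rho) = 2 * (rho * (n%:R - 1)).
  have n1' : n%:R - 1 = (n.-1)%:R :> R by rewrite -subn1 natrB.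
  by rewrite sumr_const cardC1 card_ord n1' -[LHS]mulr_natr; ring.
have -> : bary_scale = 2 * (rho * n%:R) by rewrite /bary_scale; ring.
rewrite [rho * (_ - _)]mulrBr mulr1 => H1 H2.
lra.
Qed.

(** X_i is [bary_scale] times its coordinate minus rho, and the constant is spread over all letters
    as rho sum_j T_j. *)
Lemma wrep_bary_var i : wrep bary 1 bary_scale (mvars R i).
Proof.
pose q j := (if j == lift ord0 i then bary_scale else 0) - rho.
exists (fun j => (q j)%:MP).
  move=> j; exists (q j) => //; rewrite /q.
  have rk := rho_le_bary_scale.
  by have r1 := rho1; case: eqP => _; rewrite ler_norml; apply/andP; split; lra.
rewrite (eq_bigr (fun j => (if j == lift ord0 i then bary_scale *: bary j else 0)
   - rho *: bary j)); last first.
  move=> j _; rewrite mulrC mul_mpolyC /q scalerBl; case: eqP => //= _.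
  by rewrite scale0r.
rewrite sumrB -scaler_sumr bary_sum -big_mkcond big_pred1_eq bary_lift scalerA.
by rewrite mulfV ?gt_eqF ?bary_scale_gt0 // scale1r alg_mpolyC addrK.
Qed.

Lemma wrep_bary_exists (P : {mpoly R[n]}) :
  exists D, exists2 C : R, 0 <= C & wrep bary D C P.
Proof.
have k0 : 0 <= bary_scale by apply/ltW/bary_scale_gt0.
have pad := @wrep_pad _ _ _ bary _ _ _ _ bary_sum.
elim/mpolyind: P => [|c a P _ _ [D [C C0 HP]]].
  by exists 0%N, 0 => //; apply: wrep0.
suff [E [M M0 HX]] : exists E, exists2 M : R, 0 <= M & wrep bary E M ('X_[a] : {mpoly R[n]}).
  exists (maxn E D), (`|c| * M + C); first by rewrite addr_ge0 // mulr_ge0.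
  apply: wrepD; last by apply: pad HP; apply: leq_maxr.
  by apply: wrepZ; apply: pad HX; apply: leq_maxl.
rewrite mpolyXE_id; elim: (index_enum _) => [|i r [E [M M0 HX]]].
  exists 0%N, 1 => //; rewrite big_nil /=; exists 1; rewrite ?normr1 //.
rewrite big_cons; exists (1 * a i + E)%N, (bary_scale ^+ a i * M).
  by rewrite mulr_ge0 // exprn_ge0.
by apply: wrepM => //; apply: wrep_exp => //; apply: wrep_bary_var.
Qed.

Definition ball_poly (N : R) : {mpoly R[n]} := N%:MP - \sum_(i < n) 'X_i ^+ 2.

Lemma tdeg_ball N : tdeg_le 2 (ball_poly N)%:P.
Proof.
rewrite /ball_poly polyCB; apply: tdeg_leD.
  by apply: tdeg_le_polyC; rewrite mmeasureC; case: eqP.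
apply: tdeg_leN; rewrite rmorph_sum /=; apply: tdeg_le_sum => i _.
rewrite polyC_exp -[2%N]mul1n; apply: tdeg_leX; apply: tdeg_le_polyC.
by rewrite msizeX mdeg1.
Qed.

Lemma is_sos_cst (c : R) : 0 <= c -> is_sos ((c%:MP)%:P : {poly {mpoly R[n]}}).
Proof.
move=> c0; apply: is_sos_morph; apply: is_sos_morph.
by rewrite -(sqr_sqrtr c0); apply: is_sos_sqr.
Qed.

Lemma tdeg_cst k (c : R) : tdeg_le k ((c%:MP)%:P : {poly {mpoly R[n]}}).
Proof. by apply: tdeg_le_polyC; rewrite mmeasureC; case: eqP. Qed.

Lemma cert_bary (N : R) j : N <= rho ^+ 2 -> cert (ball_poly N)%:P 2 (bary j)%:P.
Proof.
move=> Nr; have r0 : 0 < rho by apply: lt_le_trans rho1.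
(* e = 1 gives the forms X_i + rho, and e = -1 the summands rho - X_i of the coordinate of index
   0. *)
have lin i (e : R) : e ^+ 2 = 1 ->
    cert (ball_poly N)%:P 2 (rho%:MP + e *: 'X_i)%:P.
  move=> e2.
  (* 2 rho (rho + e x_i) = (rho + e x_i)^2 + (rho^2 - N) + sum_(l != i) x_l^2
     + (N - |x|^2) *)
  pose A : {mpoly R[n]} := (rho%:MP + e *: 'X_i) ^+ 2 + (rho ^+ 2 - N)%:MP +
    \sum_(l < n | l != i) 'X_l ^+ 2.
  exists (((2 * rho)^-1%:MP)%:P * A%:P), ((2 * rho)^-1%:MP)%:P.
  have i0 : 0 <= (2 * rho)^-1 by rewrite invr_ge0 mulr_ge0 // ltW.
  have dX l : tdeg_le 1 (('X_l : {mpoly R[n]})%:P).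
    by apply: tdeg_le_polyC; rewrite msizeX mdeg1.
  split.
  - apply: is_sosM; first exact: is_sos_cst.
    rewrite /A !polyCD; apply: is_sosD; first apply: is_sosD.
    + by rewrite polyC_exp; apply: is_sos_sqr.
    + by apply: is_sos_cst; rewrite subr_ge0.
    + rewrite rmorph_sum /=; apply: is_sos_sum => l _; rewrite polyC_exp.
      exact: is_sos_sqr.
  - exact: is_sos_cst.
  - apply: tdeg_leZ; rewrite /A !polyCD; apply: tdeg_leD; first apply: tdeg_leD.
    + rewrite polyC_exp -[2%N]mul1n; apply: tdeg_leX; rewrite polyCD.
      apply: tdeg_leD; first exact: tdeg_cst.
      by rewrite -mul_mpolyC polyCM; apply: tdeg_leZ.
    + exact: tdeg_cst.
    + rewrite rmorph_sum /=; apply: tdeg_le_sum => l _; rewrite polyC_exp.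
      by rewrite -[2%N]mul1n; apply: tdeg_leX.
  - exact: tdeg_cst.
  - rewrite -!polyCM -polyCD; congr (_%:P); rewrite -mulrDr mul_mpolyC.
    apply: (@scalerI _ _ (2 * rho)); first by rewrite mulf_neq0 ?gt_eqF.
    rewrite scalerA mulfV ?mulf_neq0 ?gt_eqF // scale1r /A /ball_poly.
    rewrite (bigD1 i (P := predT)) //= -!mul_mpolyC.
    have CX (c : R) k : (c ^+ k)%:MP = c%:MP ^+ k :> {mpoly R[n]} by rewrite rmorphXn.
    rewrite mpolyCB mpolyCM CX.
    have E2 : e%:MP ^+ 2 = 1 :> {mpoly R[n]} by rewrite -CX e2 mpolyC1.
    rewrite mpolyC_nat.
    set s := \sum_(l < n | l != i) _.
    transitivity (rho%:MP ^+ 2 + 2%:R * rho%:MP * (e%:MP * 'X_i) +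
       e%:MP ^+ 2 * 'X_i ^+ 2 + rho%:MP ^+ 2 - 'X_i ^+ 2 : {mpoly R[n]}).
      by rewrite E2; ring.
    by ring.
have k0 : 0 <= bary_scale^-1 by rewrite invr_ge0 ltW // bary_scale_gt0.
have scal P : cert (ball_poly N)%:P 2 P -> cert (ball_poly N)%:P 2 ((bary_scale^-1%:MP)%:P * P).
  move=> [A [B [sA sB dA dB ->]]].
  exists ((bary_scale^-1%:MP)%:P * A), ((bary_scale^-1%:MP)%:P * B); split.
  - by apply: is_sosM => //; apply: is_sos_cst.
  - by apply: is_sosM => //; apply: is_sos_cst.
  - exact: tdeg_leZ.
  - exact: tdeg_leZ.
  - by ring.
case: (unliftP ord0 j) => [i|] ->.
  rewrite bary_lift -mul_mpolyC polyCM; apply: scal.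
  by rewrite addrC -['X_i]scale1r; apply: lin; rewrite expr1n.
rewrite bary_ord0 -mul_mpolyC polyCM; apply: scal.
rewrite rmorph_sum /=; apply: cert_sum => i.
by rewrite -scaleN1r; apply: lin; rewrite sqrrN expr1n.
Qed.

End Barycentric.

(** * Polynomials on the cylinder *)

Section CylinderPolynomials.
Variables (R : realType) (n : nat).
Implicit Types f : {poly {mpoly R[n]}}.

Lemma bullet_norm_ge0 f : 0 <= bullet_norm f.
Proof.
rewrite /bullet_norm; elim/big_ind: _ => [//|x y x0 _|i _]; first by rewrite le_max x0.
by elim/big_ind: _ => [//|x y x0 _|a _]; rewrite ?le_max ?x0.
Qed.

Lemma ler_bigmax_cond (I : finType) (F : I -> R) i : F i <= \big[Num.max/0]_j F j.
Proof. by rewrite (bigD1 i) //= le_max lexx. Qed.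

Lemma msize_coef f i : (msize f`_i <= (degX f).+1)%N.
Proof.
have [fi|/leq_sizeP -> //] := ltnP i (size f); last by rewrite msize0.
have : ((msize f`_i).-1 <= degX f)%N.
  exact: (@leq_bigmax _ (fun i : 'I_(size f) => (msize f`_i).-1) (Ordinal fi)).
by case: (msize _).
Qed.

Lemma coef_bullet_norm f i (a : 'X_{1..n}) : (mdeg a <= degX f)%N ->
  `|f`_i@_a / multinomial_coef R a| <= bullet_norm f.
Proof.
move=> ad; have [fi|/leq_sizeP -> //] := ltnP i (size f); last first.
  by rewrite mcoeff0 mul0r normr0 bullet_norm_ge0.
have i' : (i < (degY f).+1)%N by rewrite /degY; case: (size f) fi.
pose F (i : nat) (b : 'X_{1..n < (degX f).+1}) := `|f`_i@_b / multinomial_coef R b|.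
apply: (le_trans (ler_bigmax_cond (F i) (BMultinom (ad : (mdeg a < (degX f).+1)%N)))).
exact: (ler_bigmax_cond (fun i : 'I_(degY f).+1 => \big[Num.max/0]_b F i b) (Ordinal i')).
Qed.

Lemma coef_decomposition f i : exists2 F : nat -> {mpoly R[n]},
  forall k, wrep (mvars R (n := n)) k (bullet_norm f) (F k) &
  f`_i = \sum_(k < (degX f).+1) F k.
Proof.
apply: homogeneous_decomposition; [exact: bullet_norm_ge0|exact: msize_coef|].
by move=> a; apply: coef_bullet_norm.
Qed.

Lemma meval_mvars (x : 'I_n -> R) i : (mvars R i).@[x] = x i.
Proof. exact: mevalXU. Qed.

Lemma coef_simplex_bound f i x : simplex R n x ->
  `|(f`_i).@[x 0]| <= bullet_norm f * ((degX f)%:R + 1).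
Proof.
move=> [x1 x0]; have [F HF ->] := coef_decomposition f i.
have L0 := bullet_norm_ge0 f.
rewrite meval_sum; apply: (le_trans (ler_norm_sum _ _ _)).
have -> : bullet_norm f * ((degX f)%:R + 1) = \sum_(k < (degX f).+1) bullet_norm f.
  by rewrite sumr_const card_ord natr1 -[RHS]mulr_natr.
apply: ler_sum => k _.
have Hx : \sum_j `|(mvars R j).@[x 0]| <= 1.
  apply: le_trans x1; apply: ler_sum => j _; by rewrite meval_mvars ger0_norm.
by have := wrep_eval_le L0 Hx (HF k); rewrite expr1n mulr1.
Qed.

Lemma coef_lipschitz f i (x y : 'rV[R]_n) s e : 1 <= s ->
  \sum_j `|x 0 j| <= s -> \sum_j `|y 0 j| <= s -> \sum_j `|x 0 j - y 0 j| <= e ->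
  `|(f`_i).@[x 0] - (f`_i).@[y 0]| <=
    bullet_norm f * ((degX f)%:R + 1) * (degX f)%:R * s ^+ degX f * e.
Proof.
move=> s1 Hx Hy He; have [F HF ->] := coef_decomposition f i.
have L0 := bullet_norm_ge0 f; set d := degX f.
have e0 : 0 <= e by apply: le_trans He; apply: sumr_ge0.
have s0 : 0 <= s by apply: le_trans s1.
rewrite !meval_sum -sumrB; apply: (le_trans (ler_norm_sum _ _ _)).
have -> : bullet_norm f * (d%:R + 1) * d%:R * s ^+ d * e =
    \sum_(k < d.+1) bullet_norm f * d%:R * s ^+ d * e.
  rewrite sumr_const card_ord natr1 -[RHS]mulr_natr.
  by rewrite -!mulrA; congr (_ * _); rewrite mulrC !mulrA.
apply: ler_sum => k _.
have Hx' : \sum_j `|(mvars R j).@[x 0]| <= s by under eq_bigr do rewrite meval_mvars.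
have Hy' : \sum_j `|(mvars R j).@[y 0]| <= s by under eq_bigr do rewrite meval_mvars.
have He' : \sum_j `|(mvars R j).@[x 0] - (mvars R j).@[y 0]| <= e.
  by under eq_bigr do rewrite !meval_mvars.
apply: (le_trans (wrep_lipschitz L0 s1 Hx' Hy' He' (HF k))).
have kd : (k <= d)%N by rewrite -ltnS.
apply: ler_wpM2r => //; apply: ler_pM => //; rewrite ?mulr_ge0 ?exprn_ge0 //.
  by rewrite ler_wpM2l // ler_nat.
by rewrite ler_weXn2l.
Qed.

Lemma evalXYE f (m : nat) (x : 'rV[R]_n) y : (size f <= m.+1)%N ->
  evalXY f x y = \sum_(i < m.+1) (f`_i).@[x 0] * y ^+ i.
Proof.
move=> fm; rewrite /evalXY (horner_coef_wide _ fm) meval_sum; apply: eq_bigr => i _.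
by rewrite mevalM rmorphXn /= mevalC.
Qed.

Lemma horner_evalX f (x : 'rV[R]_n) y : (evalX f x).[y] = evalXY f x y.
Proof.
rewrite /evalX /evalXY -[y in LHS](mevalC (x 0)).
by rewrite horner_map.
Qed.

Lemma evalXYZE f m (x : 'rV[R]_n) y z : degY f = m ->
  evalXYZ (homogY f) x y z =
  \sum_(i < m.+1) (f`_i).@[x 0] * y ^+ i * z ^+ (m - i).
Proof.
move=> <-.
rewrite /evalXYZ /homogY horner_poly horner_sum meval_sum; apply: eq_bigr => i _.
rewrite hornerM hornerZ hornerXn -polyC_exp hornerC !mevalM !rmorphXn /= !mevalC.
by ring.
Qed.

(** With r = sqrt(1 + y^2) the point (y/r, 1/r) lies on the circle, and homogeneity of degree 2h
    gives f(x, y) as r^(2h) times the value there. As the degree is even, r^(2h) = (1 + y^2)^h is a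
    polynomial in y. *)
Lemma evalXY_homog f h (x : 'rV[R]_n) y (fb : R) : degY f = h.*2 ->
  (forall y z, y ^+ 2 + z ^+ 2 = 1 -> fb <= evalXYZ (homogY f) x y z) ->
  fb * (1 + y ^+ 2) ^+ h <= evalXY f x y.
Proof.
move=> fh Hfb; pose r := Num.sqrt (1 + y ^+ 2).
have p0 : 0 < 1 + y ^+ 2 by rewrite ltr_pwDl // sqr_ge0.
have r0 : 0 < r by rewrite sqrtr_gt0.
have r2 : r ^+ 2 = 1 + y ^+ 2 by rewrite sqr_sqrtr // ltW.
have rn : r != 0 by rewrite gt_eqF.
have := Hfb (y / r) r^-1.
have -> : (y / r) ^+ 2 + r^-1 ^+ 2 = 1.
  by rewrite exprMn exprVn -[X in _ + X]mul1r -mulrDl addrC r2 mulfV ?gt_eqF.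
move=> /(_ erefl); rewrite (evalXYZE _ _ _ fh).
have rh : r ^+ h.*2 = (1 + y ^+ 2) ^+ h by rewrite -mul2n exprM r2.
rewrite -rh => H; have rh0 : 0 < r ^+ h.*2 by rewrite exprn_gt0.
rewrite -(ler_pM2r rh0) in H; apply: (le_trans H).
rewrite (@evalXYE f h.*2) -?fh ?leqSpred // fh mulr_suml; apply: ler_sum => i _.
have ih : (i <= h.*2)%N by rewrite -ltnS.
have rE : r ^+ h.*2 = r ^+ i * r ^+ (h.*2 - i) by rewrite -exprD subnKC.
rewrite rE exprMn !exprVn le_eqVlt; apply/orP; left; apply/eqP.
by field; rewrite !expf_neq0.
Qed.

Lemma ler_norm_powS (y : R) h i : (i <= h.*2)%N -> `|y| ^+ i <= (1 + y ^+ 2) ^+ h.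
Proof.
move=> ih; have p1 : 1 <= 1 + y ^+ 2 by rewrite lerDl sqr_ge0.
have [y1|y1] := leP `|y| 1.
  by apply: (@le_trans _ _ 1); [exact: exprn_ile1|exact: exprn_ege1].
apply: (@le_trans _ _ (`|y| ^+ h.*2)); first by rewrite ler_weXn2l // ltW.
rewrite -mul2n exprM real_normK ?num_real //; apply: lerXn2r.
- by rewrite nnegrE sqr_ge0.
- by rewrite nnegrE addr_ge0 // sqr_ge0.
- by rewrite lerDr.
Qed.

Lemma norm_evalXY_le f h (x : 'rV[R]_n) y (K : R) : (size f <= h.*2.+1)%N ->
  (forall i, `|(f`_i).@[x 0]| <= K) ->
  `|evalXY f x y| <= (h.*2.+1)%:R * K * (1 + y ^+ 2) ^+ h.
Proof.
move=> sf HK; rewrite (evalXYE _ _ sf); apply: (le_trans (ler_norm_sum _ _ _)).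
have -> : (h.*2.+1)%:R * K * (1 + y ^+ 2) ^+ h =
    \sum_(i < h.*2.+1) K * (1 + y ^+ 2) ^+ h.
  by rewrite sumr_const card_ord -[RHS]mulr_natl mulrA.
apply: ler_sum => i _; rewrite normrM normrX; apply: ler_pM => //.
by apply: ler_norm_powS; rewrite -ltnS.
Qed.

Lemma evalXYB f1 f2 (x : 'rV[R]_n) y : evalXY (f1 - f2) x y = evalXY f1 x y - evalXY f2 x y.
Proof. by rewrite /evalXY hornerD hornerN mevalB. Qed.

End CylinderPolynomials.

(** * Polya's theorem over the cylinder *)

Section PolyaCertificate.
Variables (R : realType) (n : nat) (rho : R).
Hypotheses (n0 : (0 < n)%N) (rho1 : 1 <= rho).

Lemma sum_frequencies p N (w : {ffun 'I_N -> 'I_p}) : (0 < N)%N ->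
  \sum_(j < p) #|[pred k | w k == j]|%:R / N%:R = 1 :> R.
Proof.
move=> N0; rewrite -mulr_suml -natr_sum.
suff -> : (\sum_(j < p) #|[pred k | w k == j]| = N)%N by rewrite mulfV // pnatr_eq0 -lt0n.
rewrite -[RHS]card_ord -sum1_card (partition_big w predT) //=.
by apply: eq_bigr => j _; rewrite sum1_card.
Qed.

(** For a word w all coefficients in Y are compared with their values at the same point x_w, whose
    barycentric coordinates are the frequencies of w. So b_w(Y) differs from H(x_w, Y) by at most
    (2h + 1) times the Polya error times (1 + Y^2)^h, which the margin [eta] absorbs. *)
Lemma polya_cert (h D N : nat) (L eta NN : R) (H : {poly {mpoly R[n]}}) :
  NN <= rho ^+ 2 -> 0 <= L -> (0 < N)%N -> (D <= N)%N ->
  (size H <= h.*2.+1)%N ->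
  (forall i, wrep (@bary R n rho) D L H`_i) ->
  (forall x y, semialg (@bary R n rho) x -> eta * (1 + y ^+ 2) ^+ h <= evalXY H x y) ->
  (h.*2.+1)%:R * (2 * L * D%:R ^+ 2 / N%:R) <= eta ->
  cert (ball_poly n NN)%:P (h.*2 + 6 * N + 4) H.
Proof.
move=> Nr L0 N0 DN sH HW Hlow Heta.
set T := @bary R n rho in HW Hlow *.
have T1 : \sum_j T j = 1 := bary_sum n0 rho1.
have polya (i : nat) := polya_words T1 N0 DN L0 (HW i).
pose b i := sval (cid2 (polya i)).
have bE i : H`_i = \sum_w b i w *: \prod_k T (w k) by rewrite /b; case: cid2.
have bD i (w : {ffun 'I_N -> 'I_n.+1}) (x : 'rV[R]_n) :
    (forall j, (T j).@[x 0] = #|[pred k | w k == j]|%:R / N%:R) ->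
    `|b i w - (H`_i).@[x 0]| <= 2 * L * D%:R ^+ 2 / N%:R.
  by rewrite /b; case: cid2 => /= b' _ Hb'; apply: Hb'.
pose B w := \poly_(i < h.*2.+1) b i w.
have Bsos w : is_sos (B w).
  apply: nonneg_poly_sos => y.
  have [x Hx] := bary_point n0 rho1 (sum_frequencies w N0).
  have Sx : semialg T x by move=> j; rewrite Hx divr_ge0.
  have := Hlow x y Sx; rewrite (evalXYE _ _ sH) horner_poly => lowx.
  set q := _ / N%:R in Heta bD.
  have : `|\sum_(i < h.*2.+1) b i w * y ^+ i -
      \sum_(i < h.*2.+1) (H`_i).@[x 0] * y ^+ i| <= (h.*2.+1)%:R * q * (1 + y ^+ 2) ^+ h.
    rewrite -sumrB; apply: (le_trans (ler_norm_sum _ _ _)).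
    have -> : (h.*2.+1)%:R * q * (1 + y ^+ 2) ^+ h =
        \sum_(i < h.*2.+1) q * (1 + y ^+ 2) ^+ h.
      by rewrite sumr_const card_ord -[RHS]mulr_natl mulrA.
    apply: ler_sum => i _; rewrite -mulrBl normrM normrX; apply: ler_pM => //.
      exact: bD.
    by apply: ler_norm_powS; rewrite -ltnS.
  have P0 : 0 <= (1 + y ^+ 2) ^+ h by rewrite exprn_ge0 // addr_ge0 // sqr_ge0.
  have := ler_wpM2r P0 Heta; rewrite ler_norml => ? /andP[? ?]; lra.
have -> : H = \sum_w map_poly (@mpolyC n R) (B w) * \prod_k (T (w k))%:P.
  apply/polyP => i; rewrite coef_sum bE.
  have [ih|ih] := ltnP i h.*2.+1.
    apply: eq_bigr => w _; rewrite -rmorph_prod coefMC coef_map coef_poly ih /=.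
    by rewrite mul_mpolyC.
  rewrite -bE (leq_sizeP _ _ sH) // big1 // => w _.
  by rewrite -rmorph_prod coefMC coef_map coef_poly ltnNge ih /= mul0r.
apply: cert_sum => w.
(* Each of the N letters costs its own degree 2 and the 2 * 2 of a product of certificates; the
   product with b_w costs 2 * 2 once more. *)
have -> : (h.*2 + 6 * N + 4 = h.*2 + 6 * N + 2 * 2)%N by [].
apply: (certM (@tdeg_ball R n NN)).
  apply: cert_sos; first exact: is_sos_morph.
  by apply: tdeg_le_map; rewrite size_poly.
have -> : (6 * N = (2 + 2 * 2) * #|'I_N|)%N by rewrite card_ord.
apply: (cert_prod (@tdeg_ball R n NN)) => k.
exact: cert_bary.
Qed.

End PolyaCertificate.

(** * The penalised polynomial *)

Section Growth.

(** For a >= 2 constants are absorbed into powers of a, so that one exponent [K] describes the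
    growth. *)
Definition poly_bounded (F : nat -> nat) : Prop :=
  exists K, forall a, (1 < a)%N -> (F a <= a ^ K)%N.

Definition exp_bounded (F : nat -> nat) : Prop :=
  exists K, forall a, (1 < a)%N -> (F a <= 2 ^ (a ^ K))%N.

Lemma poly_bounded_cst c : poly_bounded (fun=> c).
Proof.
exists c => a a1; apply: (leq_trans (ltnW (ltn_expl c (ltnSn 1)))).
by case: c => // c; rewrite leq_exp2r.
Qed.

Lemma poly_bounded_id : poly_bounded id.
Proof. by exists 1%N => a _; rewrite expn1. Qed.

Lemma poly_boundedM F G : poly_bounded F -> poly_bounded G ->
  poly_bounded (fun a => F a * G a)%N.
Proof.
move=> [K HK] [K' HK']; exists (K + K')%N => a a1.
by rewrite expnD leq_mul ?HK ?HK'.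
Qed.

Lemma poly_boundedD F G : poly_bounded F -> poly_bounded G ->
  poly_bounded (fun a => F a + G a)%N.
Proof.
move=> [K HK] [K' HK']; exists (maxn K K').+1 => a a1.
have aP : (0 < a)%N by apply: ltnW.
apply: (@leq_trans (2 * a ^ maxn K K')).
  rewrite mul2n -addnn leq_add //; [apply: (leq_trans (HK _ a1))|apply: (leq_trans (HK' _ a1))].
    by rewrite leq_pexp2l // leq_maxl.
  by rewrite leq_pexp2l // leq_maxr.
by rewrite expnS leq_mul.
Qed.

Lemma poly_boundedX F k : poly_bounded F -> poly_bounded (fun a => F a ^ k)%N.
Proof.
move=> HF; elim: k => [|k IH]; first exact: (poly_bounded_cst 1).
have [K HK] := poly_boundedM HF IH.
by exists K => a a1; rewrite expnS HK.
Qed.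

Lemma exp_boundedX c F : poly_bounded F -> exp_bounded (fun a => c ^ F a)%N.
Proof.
move=> HF; have [K HK] := poly_boundedM (poly_bounded_cst c) HF.
exists K => a a1; apply: (@leq_trans (2 ^ (c * F a))); last by rewrite leq_pexp2l ?HK.
by rewrite expnM; case: (F a) => // k; rewrite leq_exp2r // ltnW // ltn_expl.
Qed.

Lemma exp_bounded_poly F : poly_bounded F -> exp_bounded F.
Proof.
move=> /(exp_boundedX 2)[K HK]; exists K => a a1; apply: leq_trans (HK a a1).
exact/ltnW/ltn_expl.
Qed.

Lemma exp_boundedM F G : exp_bounded F -> exp_bounded G ->
  exp_bounded (fun a => F a * G a)%N.
Proof.
move=> [K HK] [K' HK'].
have [M HM] : poly_bounded (fun a => a ^ K + a ^ K')%N.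
  by apply: poly_boundedD; apply: poly_boundedX; apply: poly_bounded_id.
exists M => a a1; apply: (@leq_trans (2 ^ (a ^ K + a ^ K'))).
  by rewrite expnD leq_mul ?HK ?HK'.
by rewrite leq_pexp2l ?HM.
Qed.

Lemma exp_boundedD F G : exp_bounded F -> exp_bounded G ->
  exp_bounded (fun a => F a + G a)%N.
Proof.
move=> HF HG.
have [K HK] := HF; have [K' HK'] := HG.
have [P HP] : exp_bounded (fun a => 2 * (2 ^ (a ^ K) * 2 ^ (a ^ K')))%N.
  apply: exp_boundedM; first exact/exp_bounded_poly/poly_bounded_cst.
  by apply: exp_boundedM; apply: exp_boundedX; apply: poly_boundedX; apply: poly_bounded_id.
exists P => a a1; apply: leq_trans (HP a a1).
have [A B] := (HK a a1, HK' a a1); rewrite mul2n -addnn leq_add //.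
  by apply: (leq_trans A); rewrite leq_pmulr // expn_gt0.
by apply: (leq_trans B); rewrite leq_pmull // expn_gt0.
Qed.

End Growth.

Section ScalarBounds.
Variable R : realType.

Lemma bernoulli_ge2 q : (0 < q)%N -> 2 <= (1 + q%:R^-1 : R) ^+ q.
Proof.
move=> q0; have q0' : 0 < q%:R :> R by rewrite ltr0n.
have H k : 1 + k%:R * q%:R^-1 <= (1 + q%:R^-1 : R) ^+ k.
  have i0 : 0 <= q%:R^-1 :> R by rewrite invr_ge0.
  elim: k => [|k IH]; first by rewrite mul0r addr0 expr0.
  rewrite exprSr; apply: le_trans (ler_wpM2r _ IH); last by rewrite addr_ge0.
  rewrite -natr1; have : 0 <= k%:R * q%:R^-1 * q%:R^-1 :> R by rewrite !mulr_ge0.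
  lra.
by have := H q; rewrite mulfV ?gt_eqF.
Qed.

Lemma mul_pow_le1 (v : R) k : v <= 1 -> v * (1 - v) ^+ (2 * k) <= 1.
Proof.
move=> v1; have p0 : 0 <= (1 - v) ^+ (2 * k) by rewrite exprn_ge0 // subr_ge0.
have [v0|v0] := leP 0 v.
  by rewrite mulr_ile1 // exprn_ile1 //; lra.
by apply: le_trans ler01; rewrite mulr_le0_ge0 // ltW.
Qed.

(** From (1 + 1/q)^q >= 2 follows (1 - v)^(2 q r) >= 4^r: a gap of only 1/q is compensated by an
    exponent q times larger. *)
Lemma mul_pow_le_far (v : R) q r : (0 < q)%N -> v <= - q%:R^-1 ->
  v * (1 - v) ^+ (2 * (q * r)) <= - (4 ^+ r / q%:R).
Proof.
move=> q0 vq; have q0' : 0 < q%:R^-1 :> R by rewrite invr_gt0 ltr0n.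
have P4 : 4 ^+ r <= (1 - v) ^+ (2 * (q * r)).
  have -> : 4 = 2 ^+ 2 :> R by rewrite -natrX.
  rewrite mulnCA -[leLHS]exprM [leRHS]exprM; apply: lerXn2r; rewrite ?nnegrE //.
    by rewrite exprn_ge0 //; lra.
  apply: (le_trans (bernoulli_ge2 q0)); rewrite lerXn2r ?nnegrE; lra.
have p0 : 0 <= 4 ^+ r :> R by rewrite exprn_ge0.
have v0 : v <= 0 by lra.
apply: (le_trans (ler_wnM2l v0 P4)).
by rewrite [4 ^+ r / _]mulrC -mulNr ler_wpM2r.
Qed.

(** A point within 1/b of the simplex has sum_i |x_i| <= 1 + 1/b. For d <= b the resulting factor in
    the Lipschitz constant stays below e, whence the e in [C1e]. *)
Lemma one_plus_inv_pow (b d : nat) : (0 < b)%N -> (d <= b)%N ->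
  (1 + b%:R^-1 : R) ^+ d <= expR 1.
Proof.
move=> b0 db; have b0' : 0 < b%:R :> R by rewrite ltr0n.
apply: (@le_trans _ _ (expR b%:R^-1 ^+ d)).
  by rewrite lerXn2r ?nnegrE ?expR_ge0 ?addr_ge0 ?invr_ge0 ?expR_ge1Dx.
rewrite -expRM_natl ler_expR ler_pdivrMr // mul1r ler_nat //.
Qed.

Definition circle_poly : {poly R} := 1 + 'X^2.

Lemma size_circle_pow h : (size (circle_poly ^+ h) <= h.*2.+1)%N.
Proof.
elim: h => [|h IH]; first by rewrite expr0 size_poly1.
rewrite exprS; apply: (leq_trans (size_polyMleq _ _)).
have : (size circle_poly <= 3)%N.
  by rewrite (leq_trans (size_polyD _ _)) // size_poly1 size_polyXn.
rewrite doubleS; lia.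
Qed.

Lemma coef_circle_pow h i : 0 <= (circle_poly ^+ h)`_i <= 2 ^+ h.
Proof.
elim: h i => [|h IH] i; first by rewrite !expr0 coef1 ler0n lern1 leq_b1.
rewrite exprSr {2}/circle_poly mulrDr mulr1 coefD coefMXn exprS.
have := IH i; have := IH (i - 2)%N; have p0 : 0 <= 2 ^+ h :> R by rewrite exprn_ge0.
by case: ifP => _ /andP[A1 A2] /andP[A3 A4]; apply/andP; split; lra.
Qed.

Lemma horner_circle_pow h y : (circle_poly ^+ h).[y] = (1 + y ^+ 2) ^+ h.
Proof. by rewrite horner_exp /circle_poly hornerD hornerXn -[1]/(1%:P) hornerC. Qed.

Lemma is_sos_circle_pow h : is_sos (circle_poly ^+ h).
Proof.
apply: nonneg_poly_sos => y; rewrite horner_circle_pow exprn_ge0 // addr_ge0 //.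
exact: sqr_ge0.
Qed.


End ScalarBounds.

(** * Choice of the parameters and positivity on the large simplex *)

Section PenalisedPolynomial.
Variables (R : realType) (n s : nat) (rho : R) (g : 'I_s -> {mpoly R[n]}).
Variables (G K C1 C2 : nat).
Hypotheses (n0 : (0 < n)%N) (s0 : (0 < s)%N) (rho1 : 1 <= rho).
Hypotheses (K0 : (0 < K)%N) (C20 : (0 < C2)%N).
Hypothesis C1e : 8 * expR 1 <= C1%:R :> R.
Hypothesis C2k : n%:R * bary_scale n rho <= C2%:R.
Hypothesis g_wrep : forall j, wrep (@bary R n rho) G 1 (g j).
Hypothesis g_simplex : semialg g `<=` simplex R n.
Hypothesis g_loj : forall b x, (0 < b)%N -> semialg (@bary R n rho) x ->
  (forall j, - (K%:R * b%:R ^+ K)^-1 <= (g j).@[x 0]) ->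
  exists2 y, semialg g y & \sum_i `|x 0 i - y 0 i| <= b%:R^-1.

(* Here a bounds degX f, degY f + 1 and bullet_norm f / fb.  The perturbation of f is
   controlled at distance 1 / inverse_radius from semialg g; beyond it some g j is
   below - 1 / inverse_gap; gap_exponent makes (1 + 1 / inverse_gap) to the power
   2 * penalty_exponent dominate f; and word_length and fb * word_bound are the
   parameters of wrep for the penalised polynomial. *)
Definition inverse_radius (a : nat) : nat := C1 * a ^ 4.
Definition inverse_gap (a : nat) : nat := K * inverse_radius a ^ K.
Definition gap_exponent (a : nat) : nat := inverse_gap a + 4 * s + 2 + 3 * a + C2 * a.
Definition penalty_exponent (a : nat) : nat := inverse_gap a * gap_exponent a.
Definition word_length (a : nat) : nat := a + G * (2 * penalty_exponent a + 1).
Definition word_bound (a : nat) : nat := 2 * a ^ 2 * C2 ^ a + 2 ^ a * 4 ^ penalty_exponent a.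
Definition polya_exponent (a : nat) : nat := 4 * a * word_length a ^ 2 * word_bound a.

Definition penalty (k : nat) : {mpoly R[n]} :=
  \sum_(j < s) g j * (1 - g j) ^+ (2 * k).

Lemma wrep_g_power j k : wrep (@bary R n rho) (G * (2 * k)) (4 ^+ k) ((1 - g j) ^+ (2 * k)).
Proof.
have -> : 4 ^+ k = 2 ^+ (2 * k) :> R by rewrite exprM; congr (_ ^+ _); rewrite -natrX.
apply: wrep_exp => //; have -> : 2 = 1 + `|-1| * 1 :> R by rewrite normrN1 mulr1.
apply: wrepD.
  apply: (@wrep_pad _ _ _ _ 0); rewrite ?bary_sum //=.
  by exists 1; rewrite ?normr1 // mpolyC1.
by rewrite -[X in wrep _ _ _ X]scaleN1r; apply: wrepZ.
Qed.

Lemma wrep_penalty k :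
  wrep (@bary R n rho) (G * (2 * k + 1)) (s%:R * 4 ^+ k) (penalty k).
Proof.
have -> : s%:R * 4 ^+ k = \sum_(j < s) 4 ^+ k :> R.
  by rewrite sumr_const card_ord mulr_natl.
have -> : (G * (2 * k + 1) = G + G * (2 * k))%N by rewrite mulnDr muln1 addnC.
apply: wrep_sum => j; rewrite -[4 ^+ k]mul1r.
by apply: wrepM; [rewrite exprn_ge0|exact: g_wrep|exact: wrep_g_power].
Qed.

Lemma simplex_sum1 x : semialg (@bary R n rho) x ->
  \sum_j `|(@bary R n rho j).@[x 0]| <= 1.
Proof.
move=> Tx; rewrite (eq_bigr (fun j => (@bary R n rho j).@[x 0])); last first.
  by move=> j _; rewrite ger0_norm.
by rewrite -meval_sum bary_sum // meval1.
Qed.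

Lemma g_le1 x j : semialg (@bary R n rho) x -> (g j).@[x 0] <= 1.
Proof.
move=> Tx; apply: le_trans (ler_norm _) _.
by have := wrep_eval_le ler01 (simplex_sum1 Tx) (g_wrep j); rewrite expr1n mulr1.
Qed.

Lemma meval_penalty k (x : 'I_n -> R) :
  (penalty k).@[x] = \sum_(j < s) (g j).@[x] * (1 - (g j).@[x]) ^+ (2 * k).
Proof.
rewrite meval_sum; apply: eq_bigr => j _.
by rewrite mevalM rmorphXn rmorphB /= meval1.
Qed.

Lemma penalty_le k x : semialg (@bary R n rho) x -> (penalty k).@[x 0] <= s%:R.
Proof.
move=> Tx; rewrite meval_penalty.
apply: (@le_trans _ _ (\sum_(j < s) 1)).
  by apply: ler_sum => j _; apply: mul_pow_le1; apply: g_le1.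
by rewrite sumr_const card_ord.
Qed.

Lemma penalty_far q r x j : (0 < q)%N -> semialg (@bary R n rho) x ->
  (g j).@[x 0] <= - q%:R^-1 ->
  (penalty (q * r)).@[x 0] <= s%:R - 4 ^+ r / q%:R.
Proof.
move=> q0 Tx gj; rewrite meval_penalty (bigD1 j) //=.
have H1 := mul_pow_le_far r q0 gj.
have H2 : \sum_(i < s | i != j) (g i).@[x 0] * (1 - (g i).@[x 0]) ^+ (2 * (q * r)) <=
    \sum_(i < s | i != j) 1.
  by apply: ler_sum => i _; apply: mul_pow_le1; apply: g_le1.
have H3 : \sum_(i < s | i != j) 1 <= s%:R :> R.
  rewrite sumr_const ler_nat; apply: leq_trans (max_card _) _.
  by rewrite card_ord.
rewrite addrC; apply: lerD => //; exact: le_trans H3.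
Qed.

(** Rewriting an X_i in barycentric coordinates costs n [bary_scale] <= C2 per letter; d + 1 counts
    the homogeneous parts, padded to the common length d. *)
Lemma coef_wrep_bary f i : wrep (@bary R n rho) (degX f)
  (bullet_norm f * ((degX f)%:R + 1) * C2%:R ^+ degX f) f`_i.
Proof.
have [F HF ->] := coef_decomposition f i; have L0 := bullet_norm_ge0 f.
set d := degX f; set L := bullet_norm f in HF L0 *.
have k0 : 0 <= bary_scale n rho by apply/ltW/bary_scale_gt0.
have -> : L * (d%:R + 1) * C2%:R ^+ d = \sum_(k < d.+1) L * C2%:R ^+ d.
  by rewrite sumr_const card_ord natr1 -[RHS]mulr_natr mulrAC.
apply: wrep_sum => k; have kd : (k <= d)%N by rewrite -ltnS.
apply: (@wrep_pad _ _ _ _ k) => //; first exact: bary_sum.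
apply: wrep_le (wrep_subst L0 k0 (wrep_bary_var n0 rho1) (HF k)).
have C21 : 1 <= C2%:R :> R by rewrite ler1n.
rewrite ler_wpM2l //; apply: (@le_trans _ _ (C2%:R ^+ k)).
  by apply: lerXn2r => //; rewrite nnegrE ?(mulr_ge0 (ler0n _ _) k0).
by rewrite ler_weXn2l.
Qed.

Section FixedPolynomial.
Variables (f : {poly {mpoly R[n]}}) (h a : nat) (fb : R).
Hypotheses (a1 : (1 < a)%N) (fd : (degX f <= a)%N) (fm : (size f <= h.*2.+1)%N).
Hypotheses (ha : (h.*2.+1 <= a)%N) (fb0 : 0 < fb) (fL : bullet_norm f <= a%:R * fb).
Hypothesis f_low : forall x y, semialg g x -> fb * (1 + y ^+ 2) ^+ h <= evalXY f x y.

Definition lam : R := fb / (4 * s%:R).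

Definition penalised : {poly {mpoly R[n]}} :=
  f - map_poly (@mpolyC n R) (lam *: circle_poly R ^+ h) * (penalty (penalty_exponent a))%:P.

Lemma lam_gt0 : 0 < lam.
Proof. by rewrite divr_gt0 // mulr_gt0 // ltr0n. Qed.

Lemma lamM : lam * s%:R = fb / 4.
Proof. by rewrite /lam; field; rewrite pnatr_eq0 -lt0n. Qed.

Lemma size_penalised : (size penalised <= h.*2.+1)%N.
Proof.
apply: leq_trans (size_polyD _ _) _; rewrite geq_max fm size_polyN.
apply/leq_sizeP => i hi; rewrite coefMC coef_map /= coefZ.
by rewrite (leq_sizeP _ _ (size_circle_pow R h)) // mulr0 mpolyC0 mul0r.
Qed.

Lemma coef_bound_a : bullet_norm f * ((degX f)%:R + 1) * C2%:R ^+ degX f <=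
  fb * (2 * a ^ 2 * C2 ^ a)%:R.
Proof.
have L0 := bullet_norm_ge0 f; rewrite !natrM !natrX.
have C21 : 1 <= C2%:R :> R by rewrite ler1n.
have -> : fb * (2 * a%:R ^+ 2 * C2%:R ^+ a) = (a%:R * fb) * (2 * a%:R) * C2%:R ^+ a.
  by ring.
apply: ler_pM; rewrite ?exprn_ge0 ?mulr_ge0 ?addr_ge0 //.
  apply: ler_pM; rewrite ?addr_ge0 //.
  by rewrite natr1 -natrM ler_nat -addn1 mul2n -addnn leq_add // ltnW.
by rewrite ler_weXn2l.
Qed.

Lemma wrep_penalised i :
  wrep (@bary R n rho) (word_length a) (fb * (word_bound a)%:R) penalised`_i.
Proof.
have pad := @wrep_pad _ _ _ (@bary R n rho) _ _ _ _ (bary_sum n0 rho1).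
rewrite coefB coefMC coef_map /= coefZ /word_bound natrD mulrDr; apply: wrepD.
  apply: wrep_le coef_bound_a _; apply: pad (coef_wrep_bary f i).
  by rewrite /word_length (leq_trans fd) // leq_addr.
set c := lam * _; rewrite -mulNr -mpolyCN mul_mpolyC.
apply: (@wrep_le _ _ _ _ _ (`|- c| * (s%:R * 4 ^+ penalty_exponent a))); last first.
  apply: wrepZ; apply: pad (wrep_penalty _).
  by rewrite /word_length leq_addl.
have /andP[c0 c1] := coef_circle_pow R h i.
have l0 := lam_gt0; have lM := lamM.
rewrite normrN /c normrM (gtr0_norm l0) (ger0_norm c0) natrM !natrX.
have -> : lam * (circle_poly R ^+ h)`_i * (s%:R * 4 ^+ penalty_exponent a) =
  (lam * s%:R) * ((circle_poly R ^+ h)`_i * 4 ^+ penalty_exponent a) by ring.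
have fb4 : 0 <= fb / 4 by rewrite divr_ge0 // ltW.
rewrite lM; apply: ler_pM => //.
- by rewrite mulr_ge0 // exprn_ge0.
- by have := fb0; lra.
- apply: ler_wpM2r; first by rewrite exprn_ge0.
  apply: (le_trans c1); rewrite ler_weXn2l ?ler1n //.
  by apply: leq_trans ha; rewrite -addnn -addnS leq_addr.
Qed.

Lemma evalXY_penalised x y : evalXY penalised x y =
  evalXY f x y - lam * (1 + y ^+ 2) ^+ h * (penalty (penalty_exponent a)).@[x 0].
Proof.
rewrite evalXYB; congr (_ - _); rewrite /evalXY hornerM hornerC mevalM; congr (_ * _).
by rewrite horner_map /= mevalC hornerZ horner_circle_pow.
Qed.

Lemma inverse_radius_gt0 : (0 < inverse_radius a)%N.
Proof.
rewrite muln_gt0 expn_gt0 (ltnW a1) andbT; rewrite -(ltr_nat R).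
by apply: lt_le_trans C1e; rewrite mulr_gt0 // expR_gt0.
Qed.

Lemma inverse_gap_gt0 : (0 < inverse_gap a)%N.
Proof. by rewrite muln_gt0 K0 expn_gt0 inverse_radius_gt0. Qed.

Lemma f_near (x x' : 'rV[R]_n) y : simplex R n x' ->
  \sum_i `|x 0 i - x' 0 i| <= (inverse_radius a)%:R^-1 ->
  evalXY f x' y - fb / 4 * (1 + y ^+ 2) ^+ h <= evalXY f x y.
Proof.
move=> [x'1 x'0]; set b := inverse_radius a => Hxx.
have b0 : (0 < b)%N := inverse_radius_gt0.
have b0' : 0 < b%:R :> R by rewrite ltr0n.
have i0 : 0 <= b%:R^-1 :> R by rewrite invr_ge0 ltW.
have s1 : 1 <= 1 + b%:R^-1 :> R by rewrite lerDl.
have Hx' : \sum_j `|x' 0 j| <= 1.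
  by apply: le_trans x'1; apply: ler_sum => j _; rewrite ger0_norm.
have Hx : \sum_j `|x 0 j| <= 1 + b%:R^-1.
  apply: le_trans (lerD Hx' Hxx); rewrite -big_split /=; apply: ler_sum => j _.
  by rewrite -{1}[x 0 j](subrK (x' 0 j)) addrC; apply: ler_normD.
have Lip i := coef_lipschitz f i s1 Hx (le_trans Hx' s1) Hxx.
have L0 := bullet_norm_ge0 f.
move: Lip L0 fL fd; set d := degX f; set L := bullet_norm f => Lip L0 fL' fd'.
set E := L * (d%:R + 1) * d%:R * (1 + b%:R^-1) ^+ d * b%:R^-1 in Lip.
have ab : (a <= b)%N.
  rewrite /b /inverse_radius; have C10 : (0 < C1)%N by move: b0; rewrite muln_gt0 => /andP[].
  by rewrite (expnD a 1 3) mulnCA expn1 leq_pmulr // muln_gt0 C10 expn_gt0 (ltnW a1).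
have pd : (1 + b%:R^-1 : R) ^+ d <= expR 1.
  by apply: one_plus_inv_pow => //; apply: leq_trans ab.
(* As 2h + 1, d and ||f||_bullet / fb are at most a and d + 1 is at most 2a, the left-hand side is
   at most 2 e fb a^4 / b; b = C1 a^4 with C1 >= 8 e brings this down to fb / 4. *)
have EE : (h.*2.+1)%:R * E <= fb / 4.
  have a0 : 0 < a%:R :> R by rewrite ltr0n ltnW.
  have H1 : L * (d%:R + 1) * d%:R * (1 + b%:R^-1) ^+ d <=
      (a%:R * fb) * (2 * a%:R) * a%:R * expR 1.
    apply: ler_pM => //; rewrite ?mulr_ge0 ?exprn_ge0 ?addr_ge0 //.
    apply: ler_pM => //; rewrite ?mulr_ge0 ?addr_ge0 //; last by rewrite ler_nat.
    apply: ler_pM; rewrite ?addr_ge0 //.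
    by rewrite natr1 -natrM ler_nat -addn1 mul2n -addnn leq_add // ltnW.
  apply: (@le_trans _ _ (a%:R * ((a%:R * fb) * (2 * a%:R) * a%:R * expR 1 * b%:R^-1))).
    apply: ler_pM => //; last 1 first.
    - by apply: ler_wpM2r.
    - by rewrite !mulr_ge0 ?exprn_ge0 ?addr_ge0.
    by rewrite ler_nat.
  rewrite /b /inverse_radius natrM natrX.
  have C10 : 0 < C1%:R :> R by apply: lt_le_trans C1e; rewrite mulr_gt0 // expR_gt0.
  have -> : a%:R * (a%:R * fb * (2 * a%:R) * a%:R * expR 1 * (C1%:R * a%:R ^+ 4)^-1) =
      2 * fb * expR 1 / C1%:R :> R.
    by field; rewrite !gt_eqF.
  rewrite ler_pdivrMr //.
  have H2 := ler_wpM2l (ltW fb0) C1e; clearbody E L d b; lra.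
have P0 : 0 <= (1 + y ^+ 2) ^+ h by rewrite exprn_ge0 // addr_ge0 // sqr_ge0.
have : `|evalXY f x y - evalXY f x' y| <= (h.*2.+1)%:R * E * (1 + y ^+ 2) ^+ h.
  rewrite !(evalXYE _ _ fm) -sumrB; apply: (le_trans (ler_norm_sum _ _ _)).
  have -> : (h.*2.+1)%:R * E * (1 + y ^+ 2) ^+ h =
      \sum_(i < h.*2.+1) E * (1 + y ^+ 2) ^+ h.
    by rewrite sumr_const card_ord -[RHS]mulr_natl mulrA.
  apply: ler_sum => i _; rewrite -mulrBl normrM normrX; apply: ler_pM => //.
  by apply: ler_norm_powS; rewrite -ltnS.
have := ler_wpM2r P0 EE; rewrite ler_norml => H1 /andP[H2 _].
clearbody E L d b; lra.
Qed.

(** [gap_exponent] adds up one exponent of 2 per factor: x <= 2^x handles 4s and [inverse_gap], and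
    2 + 3a + C2 a handles 1 + 2 a^3 C2^a. *)
Lemma far_size : (4 * s * inverse_gap a * (1 + a * (2 * a ^ 2 * C2 ^ a)) <= 4 ^ gap_exponent a)%N.
Proof.
rewrite /gap_exponent; set q := inverse_gap a.
have E1 x : (x <= 2 ^ x)%N by apply/ltnW/ltn_expl.
apply: (@leq_trans (2 ^ (q + 4 * s + 2 + 3 * a + C2 * a))); last first.
  by rewrite leq_exp2r // addnS.
have E2 : (1 + a * (2 * a ^ 2 * C2 ^ a) <= 2 ^ (2 + 3 * a + C2 * a))%N.
  rewrite (expnD 2 (2 + 3 * a)) (expnD 2 2).
  have Ea : (a ^ 3 <= 2 ^ (3 * a))%N by rewrite mulnC expnM leq_exp2r.
  have Ec : (C2 ^ a <= 2 ^ (C2 * a))%N by rewrite expnM; case: (a) a1 => // k _; rewrite leq_exp2r.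
  have P : (0 < a ^ 3 * C2 ^ a)%N by rewrite muln_gt0 !expn_gt0 C20 (ltnW a1).
  have -> : (a * (2 * a ^ 2 * C2 ^ a) = 2 * (a ^ 3 * C2 ^ a))%N.
    by rewrite -mulnA mulnCA; congr (_ * _)%N; rewrite mulnA -expnS.
  rewrite -mulnA; apply: (@leq_trans (4 * (a ^ 3 * C2 ^ a))); last first.
    by apply: leq_mul => //; apply: leq_mul.
  by rewrite (mulnDl 2 2) leq_add2r muln_gt0.
have -> : (q + 4 * s + 2 + 3 * a + C2 * a = 4 * s + q + (2 + 3 * a + C2 * a))%N.
  by rewrite (addnC q) !addnA.
by rewrite !(expnD 2 (4 * s + q)) (expnD 2 (4 * s)) !leq_mul.
Qed.

Lemma penalised_lower_bound x y : semialg (@bary R n rho) x ->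
  fb / 2 * (1 + y ^+ 2) ^+ h <= evalXY penalised x y.
Proof.
move=> Tx; rewrite evalXY_penalised.
set P := (1 + y ^+ 2) ^+ h.
have P0 : 0 <= P by rewrite exprn_ge0 // addr_ge0 // sqr_ge0.
have l0 := lam_gt0; have lM := lamM.
have lP : 0 <= lam * P by rewrite mulr_ge0 // ltW.
have q0 := inverse_gap_gt0; have q0' : 0 < (inverse_gap a)%:R :> R by rewrite ltr0n.
have [near|] := pselect (forall j, - (inverse_gap a)%:R^-1 <= (g j).@[x 0]).
  have [x' Sx' Hx'] : exists2 x', semialg g x' &
      \sum_i `|x 0 i - x' 0 i| <= (inverse_radius a)%:R^-1.
    apply: g_loj => // [|j]; first exact: inverse_radius_gt0.
    by rewrite -natrX -natrM; apply: near.
  have H1 := f_near y (g_simplex Sx') Hx'.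
  have H2 := f_low y Sx'.
  have H3 := ler_wpM2l lP (penalty_le (penalty_exponent a) Tx).
  rewrite -/P in H1 H2; rewrite [lam * P * s%:R]mulrAC lM in H3.
  by clearbody P; lra.
move=> /existsNP[j /negP]; rewrite -ltNge => gj.
have H1 := penalty_far (gap_exponent a) q0 Tx (ltW gj).
have H2 := ler_wpM2l lP H1.
have H3 : `|evalXY f x y| <= a%:R * (fb * (2 * a ^ 2 * C2 ^ a)%:R) * P.
  have K0' : 0 <= fb * (2 * a ^ 2 * C2 ^ a)%:R by rewrite mulr_ge0 // ltW.
  apply: (le_trans (norm_evalXY_le y fm (K := fb * (2 * a ^ 2 * C2 ^ a)%:R) _)).
    move=> i; apply: le_trans coef_bound_a.
    have L0 : 0 <= bullet_norm f * ((degX f)%:R + 1) * C2%:R ^+ degX f.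
      by rewrite !mulr_ge0 ?exprn_ge0 ?addr_ge0 ?bullet_norm_ge0.
    by have := wrep_eval_le L0 (simplex_sum1 Tx) (coef_wrep_bary f i); rewrite expr1n mulr1.
  by rewrite ler_wpM2r // ler_wpM2r // ler_nat.
(* Gain from the violated constraint: the second summand pays for the bound [H3] on |f|, the first
   for lam s = fb / 4 and for the margin fb / 2. *)
have H4 : fb + fb * (a * (2 * a ^ 2 * C2 ^ a))%:R <=
    lam * (4 ^+ gap_exponent a / (inverse_gap a)%:R).
  rewrite mulrA ler_pdivlMr // /lam.
  have s0' : 0 < s%:R :> R by rewrite ltr0n.
  have := far_size; rewrite -(ler_nat R) natrM natrX => Hfar.
  have -> : fb / (4 * s%:R) * 4 ^+ gap_exponent a = (fb / (4 * s%:R)) * 4 ^+ gap_exponent a by [].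
  rewrite [leRHS]mulrAC ler_pdivlMr ?mulr_gt0 //.
  apply: le_trans (ler_wpM2l (ltW fb0) Hfar).
  rewrite !natrM natrD !natrM !natrX le_eqVlt; apply/orP; left; apply/eqP; ring.
have H5 := ler_wpM2r P0 H4.
move: H3; rewrite ler_norml => /andP[H3 _].
move: H2 H3 H5; rewrite [lam * P * (_ - _)]mulrBr [lam * P * s%:R]mulrAC lM.
have -> : lam * P * (4 ^+ gap_exponent a / (inverse_gap a)%:R) =
  lam * (4 ^+ gap_exponent a / (inverse_gap a)%:R) * P by ring.
have -> : a%:R * (fb * (2 * a ^ 2 * C2 ^ a)%:R) = fb * (a * (2 * a ^ 2 * C2 ^ a))%:R.
  by rewrite [in RHS]natrM; ring.
set c := lam * _; set d := fb * _%:R; move=> H2 H3 H5.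
have H6 := mulr_ge0 (ltW fb0) P0; clearbody P c d; lra.
Qed.

(** [polya_exponent] is chosen to turn this into an equality when 2h + 1 is replaced by its bound
    a. *)
Lemma polya_size_ok :
  (h.*2.+1)%:R * (2 * (fb * (word_bound a)%:R) * (word_length a)%:R ^+ 2 /
    (polya_exponent a)%:R) <= fb / 2.
Proof.
have a0 : 0 < a%:R :> R by rewrite ltr0n ltnW.
have F0 : 0 < (word_bound a)%:R :> R.
  by rewrite ltr0n addn_gt0 !muln_gt0 !expn_gt0 C20 (ltnW a1).
have D0 : 0 < (word_length a)%:R :> R by rewrite ltr0n addn_gt0 (ltnW a1).
rewrite /polya_exponent (natrM _ (4 * a * _)) (natrM _ (4 * a)) (natrM _ 4) natrX.
have -> : 2 * (fb * (word_bound a)%:R) * (word_length a)%:R ^+ 2 /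
    (4 * a%:R * (word_length a)%:R ^+ 2 * (word_bound a)%:R) = fb / 2 / a%:R :> R.
  by field; rewrite !gt_eqF.
have fb2 : 0 <= fb / 2 by rewrite divr_ge0 // ltW.
rewrite mulrCA -[leRHS]mulr1 (ler_wpM2l fb2) //.
rewrite ler_pdivrMr // mul1r ler_nat //.
Qed.

Lemma penalised_cert (NN : R) : NN <= rho ^+ 2 ->
  cert (ball_poly n NN)%:P (h.*2 + 6 * polya_exponent a + 4) penalised.
Proof.
move=> Nr; have aP : (0 < a)%N by apply: ltnW.
have DP : (0 < word_length a)%N by rewrite addn_gt0 aP.
have FP : (0 < word_bound a)%N by rewrite addn_gt0 !muln_gt0 !expn_gt0 C20 aP.
have FR : 0 <= fb * (word_bound a)%:R by rewrite mulr_ge0 // ltW.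
apply: (@polya_cert _ _ rho n0 rho1 h (word_length a) _ _ (fb / 2) _ _ Nr FR).
- by rewrite /polya_exponent !muln_gt0 ?expn_gt0 aP DP FP.
- apply: (@leq_trans (word_length a ^ 2)%N).
    by rewrite -{1}(expn1 (word_length a)) leq_pexp2l.
  rewrite /polya_exponent -mulnA -{1}(mul1n (word_length a ^ 2)%N) mulnCA mulnC leq_mul //.
  by rewrite !muln_gt0 aP.
- exact: size_penalised.
- exact: wrep_penalised.
- exact: penalised_lower_bound.
- exact: polya_size_ok.
Qed.

End FixedPolynomial.
End PenalisedPolynomial.

Section DegreeGrowth.
Variables (s G K C1 C2 E0 : nat).

(** Only [word_bound], and [polya_exponent] which contains it as a factor, exceed polynomial growth,
    through powers of constants whose exponents are polynomial in a. *)
Lemma exp_bounded_degree :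
  exp_bounded (fun a => a + 6 * polya_exponent s G K C1 C2 a + 4 + 2 * E0 +
    E0 * (2 * penalty_exponent s K C1 C2 a))%N.
Proof.
have cst c := poly_bounded_cst c.
have pq : poly_bounded (inverse_gap K C1).
  apply: (poly_boundedM (cst K)); apply: poly_boundedX.
  by apply: (poly_boundedM (cst C1)); apply: poly_boundedX; apply: poly_bounded_id.
have pr : poly_bounded (gap_exponent s K C1 C2).
  apply: poly_boundedD; first apply: poly_boundedD; first apply: poly_boundedD;
    first apply: poly_boundedD.
  - exact: pq.
  - exact: cst.
  - exact: cst.
  - exact: (poly_boundedM (cst 3) poly_bounded_id).
  - exact: (poly_boundedM (cst C2) poly_bounded_id).
have pk : poly_bounded (penalty_exponent s K C1 C2) := poly_boundedM pq pr.
have pD : poly_bounded (word_length s G K C1 C2).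
  apply: poly_boundedD; first exact: poly_bounded_id.
  apply: (poly_boundedM (cst G)); apply: poly_boundedD => //.
  exact: (poly_boundedM (cst 2)).
have eF : exp_bounded (word_bound s K C1 C2).
  apply: exp_boundedD; apply: exp_boundedM.
  - apply: exp_bounded_poly; apply: (poly_boundedM (cst 2)).
    by apply: poly_boundedX; apply: poly_bounded_id.
  - by apply: exp_boundedX; apply: poly_bounded_id.
  - by apply: exp_boundedX; apply: poly_bounded_id.
  - exact: exp_boundedX.
have eN : exp_bounded (polya_exponent s G K C1 C2).
  apply: exp_boundedM eF; apply: exp_bounded_poly; apply: poly_boundedM.
    by apply: (poly_boundedM (cst 4)); apply: poly_bounded_id.
  exact: poly_boundedX.
have ecst c : exp_bounded (fun=> c) := exp_bounded_poly (cst c).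
apply: exp_boundedD; first apply: exp_boundedD; first apply: exp_boundedD => //;
  first apply: exp_boundedD => //.
- exact/exp_bounded_poly/poly_bounded_id.
- exact: (exp_boundedM (ecst 6)).
- exact: ecst.
- apply: exp_bounded_poly; apply: (poly_boundedM (cst E0)).
  exact: (poly_boundedM (cst 2)).
Qed.

End DegreeGrowth.

Section FinalBounds.
Variable R : realType.

(** For E <= 4 the left-hand side is at most exp(9^K), with 9 = 2 * 4 + 1, and is absorbed by the
    factor c. For E > 4 the inequality 2 E + 1 <= E^2 bounds the exponent by E^(2K). The constant c
    adds up both requirements and 1. *)
Lemma exp_bound_real K : exists2 c : R, 1 <= c & forall (E : R) (a : nat), 0 <= E ->
  a%:R <= 2 * E + 1 -> (2 ^ (a ^ K))%:R <= c * expR (E `^ c).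
Proof.
pose c : R := expR (9 ^+ K) + (2 * K)%:R + 1; exists c.
  by rewrite lerDr addr_ge0 ?expR_ge0.
move=> E a E0 aE; have c1 : 1 <= c by rewrite lerDr addr_ge0 ?expR_ge0.
have c0 : 0 <= c by apply: le_trans c1.
have exp1 : 1 <= expR (E `^ c) by rewrite -expR0 ler_expR powR_ge0.
have H1 : (2 ^ (a ^ K))%:R <= expR ((2 * E + 1) ^+ K) :> R.
  apply: (@le_trans _ _ (expR (a%:R ^+ K))); last first.
    by rewrite ler_expR; apply: lerXn2r; rewrite ?nnegrE // addr_ge0 // mulr_ge0.
  rewrite -[a%:R ^+ K]natrX (natrX _ 2) -[(a ^ K)%:R]mulr1 expRM_natl.
  apply: lerXn2r; rewrite ?nnegrE ?expR_ge0 //.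
  by apply: le_trans (expR_ge1Dx 1); lra.
apply: (le_trans H1); have [E4|E4] := leP E 4.
  apply: (@le_trans _ _ (c * 1)); last by rewrite ler_wpM2l.
  rewrite mulr1; apply: (@le_trans _ _ (expR (9 ^+ K))).
    by rewrite ler_expR; apply: lerXn2r; rewrite ?nnegrE //; lra.
  by rewrite /c -addrA lerDl addr_ge0.
apply: (@le_trans _ _ (1 * expR (E `^ c))); last by rewrite ler_wpM2r ?expR_ge0.
rewrite mul1r ler_expR; apply: (@le_trans _ _ (E ^+ (2 * K))).
  rewrite exprM; apply: lerXn2r; rewrite ?nnegrE ?exprn_ge0 ?addr_ge0 ?mulr_ge0 //.
  by rewrite expr2; have := ler_wpM2r E0 (ltW E4); lra.
rewrite -powR_mulrn // ler_powR //; first lra.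
by rewrite /c -addrA addrCA lerDl addr_ge0 // expR_ge0.
Qed.

End FinalBounds.

Lemma distr_common_factor (A : comNzRingType) (b t q v g p : A) :
  p = v * g -> b * (t * g) + q * p = (b * t + q * v) * g.
Proof. by move=> ->; rewrite mulrDl !mulrA. Qed.

(** * Certificate in the quadratic module of the g_j *)

Section Assembly.
Variables (R : realType) (n s : nat) (g : 'I_s -> {mpoly R[n]}).
Hypotheses (n0 : (0 < n)%N) (s0 : (0 < s)%N).
Hypothesis g_simplex : semialg g `<=` simplex R n.
Hypothesis g_arch : archimedean_qm g.

Lemma tdeg_exists (P : {mpoly R[n]}) : exists k, tdeg_le k P%:P.
Proof. by exists (msize P); apply: tdeg_le_polyC; apply: leqnSn. Qed.

Lemma cylinder_certificate : exists2 W : nat -> nat, exp_bounded W &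
  forall (f : {poly {mpoly R[n]}}) h a fb, (1 < a)%N -> (degX f <= a)%N ->
    (size f <= h.*2.+1)%N -> (h.*2.+1 <= a)%N -> 0 < fb ->
    bullet_norm f <= a%:R * fb ->
    (forall x y, semialg g x -> fb * (1 + y ^+ 2) ^+ h <= evalXY f x y) ->
    exists (sigma0 : {poly {mpoly R[n]}}) (sigma : 'I_s -> {poly {mpoly R[n]}}),
      [/\ is_sos sigma0, forall i, is_sos (sigma i),
          f = sigma0 + \sum_(i < s) sigma i * (g i)%:P,
          tdeg_le (W a) sigma0 &
          forall i, tdeg_le (W a) (sigma i * (g i)%:P)].
Proof.
have [NN [NN0 [tau0 [tau [stau0 stau uE]]]]] := g_arch.
(* This choice ensures both rho >= 1 and NN <= rho^2, so that the simplex contains the ball. *)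
pose rho : R := 1 + NN.
have rho1 : 1 <= rho by rewrite lerDl ltW.
have Nrho : NN <= rho ^+ 2 by rewrite /rho; nra.
pose T := @bary R n rho.
have T1 : \sum_j T j = 1 := bary_sum n0 rho1.
have wr j := wrep_bary_exists n0 rho1 (g j).
pose Dg j := sval (cid (wr j)).
have wr' j : exists2 C : R, 0 <= C & wrep T (Dg j) C (g j) by rewrite /Dg; case: cid.
pose Cg j := sval (cid2 (wr' j)).
have Cg0 j : 0 <= Cg j by rewrite /Cg; case: cid2.
have Hg j : wrep T (Dg j) (Cg j) (g j) by rewrite /Cg; case: cid2.
(* Common word length and coefficient bound for all g_j; the rescaled g_j / C have bound 1 and
   define the same set. *)
pose G := (\max_j Dg j)%N; pose C := 1 + \sum_j Cg j.
have C0 : 0 < C by rewrite ltr_pwDl // sumr_ge0.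
pose g' j := C^-1 *: g j.
have g'w j : wrep T G 1 (g' j).
  apply: (@wrep_pad _ _ _ _ (Dg j)) => //; first exact: leq_bigmax.
  apply: wrep_le (wrepZ C^-1 (Hg j)).
  rewrite gtr0_norm ?invr_gt0 // mulrC ler_pdivrMr // mul1r /C (bigD1 j) //=.
  by rewrite addrCA lerDl addr_ge0 // sumr_ge0.
have g'E : semialg g' = semialg g.
  apply/seteqP; split=> x Hx j; have := Hx j; rewrite /g' mevalZ.
    by rewrite pmulr_rge0 ?invr_gt0.
  by rewrite pmulr_rge0 ?invr_gt0.
have [K K0 loj] := lojasiewicz g' (bary_bounded n0 rho1).
pose C1 := (Num.truncn (8 * expR 1 : R)).+1.
pose C2 := (Num.truncn (n%:R * bary_scale n rho)).+1.
have C1e : 8 * expR 1 <= C1%:R :> R by apply/ltW/truncnS_gt.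
have C2k : n%:R * bary_scale n rho <= C2%:R by apply/ltW/truncnS_gt.
have g's : semialg g' `<=` simplex R n by rewrite g'E.
have dtau j := tdeg_exists (tau j); have dg j := tdeg_exists (g j).
have [e0 He0] := tdeg_exists tau0.
pose et j := sval (cid (dtau j)); pose eg j := sval (cid (dg j)).
have Het j : tdeg_le (et j) (tau j)%:P by rewrite /et; case: cid.
have Heg j : tdeg_le (eg j) (g j)%:P by rewrite /eg; case: cid.
pose E0 := (e0 + \max_j et j + \max_j eg j)%N.
have {}He0 : tdeg_le E0 tau0%:P.
  by apply: tdeg_leW He0; rewrite /E0 -addnA leq_addr.
have {}Het j : tdeg_le E0 (tau j)%:P.
  apply: tdeg_leW (Het j); rewrite /E0 addnAC.
  by apply: leq_trans (leq_addl _ _); apply: leq_bigmax.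
have {}Heg j : tdeg_le E0 (g j)%:P.
  apply: tdeg_leW (Heg j); rewrite /E0.
  by apply: leq_trans (leq_addl _ _); apply: leq_bigmax.
(* The summands other than the last bound the part B tau_j g_j that comes from the ball; the last
   accounts for (1 - g_j)^(2k) in the penalty. *)
exists (fun a => a + 6 * polya_exponent s G K C1 C2 a + 4 + 2 * E0 +
    E0 * (2 * penalty_exponent s K C1 C2 a))%N; first exact: exp_bounded_degree.
move=> f h a fb a1 fd fm ha fb0 fL flow.
have flow' x y : semialg g' x -> fb * (1 + y ^+ 2) ^+ h <= evalXY f x y.
  by rewrite g'E; apply: flow.
have [A [B [sA sB dA dB PE]]] := penalised_cert n0 s0 rho1 K0 (ltn0Sn _) C1e C2k g'w g's
  loj a1 fd fm ha fb0 fL flow' Nrho.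
set M := (h.*2 + _ + 4)%N in dA dB.
set W := (a + _ + _ + _ + _)%N.
set k := penalty_exponent s K C1 C2 a in PE W *.
pose Q := map_poly (@mpolyC n R) (lam s fb *: circle_poly R ^+ h).
have sQ : is_sos Q.
  apply: is_sos_morph; rewrite -mul_polyC; apply: is_sosM; last exact: is_sos_circle_pow.
  by apply: is_sos_polyC; apply/ltW/lam_gt0.
have dQ : tdeg_le h.*2 Q.
  apply: tdeg_le_map; apply: leq_trans (size_scale_leq _ _) _; exact: size_circle_pow.
pose V j := (C^-1%:MP)%:P * ((1 - g' j) ^+ (2 * k))%:P.
have sV j : is_sos (V j).
  apply: is_sosM; first by apply: is_sos_cst; rewrite invr_ge0 ltW.
  by rewrite mulnC exprM polyC_exp; apply: is_sos_sqr.
have dV j : tdeg_le (E0 * (2 * k)) (V j).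
  apply: tdeg_leZ; rewrite polyC_exp; apply: tdeg_leX; rewrite polyCB.
  apply: tdeg_leD; first exact: tdeg_le1.
  apply: tdeg_leN; rewrite /g' -mul_mpolyC polyCM; apply: tdeg_leZ; exact: Heg.
have ha' : (h.*2 <= a)%N by apply: ltnW.
have h1 : (M + E0 + E0 <= W)%N.
  rewrite /M /W -addnA addnn -(mul2n E0); apply: leq_trans (leq_addr _ _).
  by rewrite !leq_add2r.
have h2 : (h.*2 + E0 * (2 * k) + E0 <= W)%N.
  rewrite /W addnAC leq_add2r leq_add // ?leq_pmull //.
  by rewrite -addnA (leq_trans ha') // leq_addr.
have fE : f = A + B * (ball_poly n NN)%:P + Q * (penalty g' k)%:P.
  by rewrite -PE /penalised subrK.
clearbody Q W M k.
(* Substituting u = tau_0 + sum_j tau_j g_j into f = A + B u + Q penalty, the multiplier of g_j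
   receives B tau_j from the ball and Q V_j from the penalty, where V_j includes the scaling 1/C. *)
exists (A + B * tau0%:P), (fun j => B * (tau j)%:P + Q * V j); split.
- by apply: is_sosD => //; apply: is_sosM => //; apply: is_sos_morph.
- move=> j; apply: is_sosD; apply: is_sosM => //; exact: is_sos_morph.
- rewrite [LHS]fE /ball_poly uE polyCD rmorph_sum /= mulrDr -!addrA; congr (_ + (_ + _)).
  rewrite mulr_sumr /penalty rmorph_sum mulr_sumr -big_split /=.
  apply: eq_bigr => j _; rewrite polyCM; apply: distr_common_factor.
  rewrite /V; move: ((1 - g' j) ^+ (2 * k)) => X; rewrite -!polyCM.
  by apply: congr1; rewrite /g' -mul_mpolyC mulrAC.
- apply: tdeg_leD; last first.
    by apply: tdeg_leW (tdeg_leM dB He0); apply: leq_trans (leq_addr E0 _) h1.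
  by apply: tdeg_leW dA; apply: leq_trans h1; rewrite -addnA leq_addr.
move=> j; rewrite mulrDl; apply: tdeg_leD.
  exact: (tdeg_leW h1 (tdeg_leM (tdeg_leM dB (Het j)) (Heg j))).
exact: (tdeg_leW h2 (tdeg_leM (tdeg_leM dQ (dV j)) (Heg j))).
Qed.

End Assembly.

(** * Reduction of the data of f to one parameter *)

Lemma fully_mic_even (R : realType) (n m : nat) (S : set 'rV[R]_n)
    (f : {poly {mpoly R[n]}}) x : S x -> fully_mic m S f ->
  (forall y, 0 < evalXY f x y) -> m = (m./2).*2.
Proof.
move=> Sx [_ /(_ x Sx) sz] pos.
have : odd (size (evalX f x)).
  by apply: positive_poly_odd_size => y; rewrite horner_evalX.
by rewrite sz /= => om; rewrite even_halfK.
Qed.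

(** At (y, z) = (1, 0) the homogenization is the leading coefficient f_m(x), which is bounded on the
    simplex. The resulting lower bound on ||f||_bullet / f^bullet keeps E from being small compared
    with m and d. *)
Lemma bullet_min_le (R : realType) (n : nat) (f : {poly {mpoly R[n]}}) (fb : R) x :
  simplex R n x -> (forall y z, y ^+ 2 + z ^+ 2 = 1 -> fb <= evalXYZ (homogY f) x y z) ->
  fb <= bullet_norm f * ((degX f)%:R + 1).
Proof.
move=> Sx H; have := H 1 0; rewrite expr1n expr0n addr0 => /(_ erefl) H1.
apply: (le_trans H1); rewrite (evalXYZE _ _ _ erefl) big_ord_recr /= big1 ?add0r.
  rewrite subnn expr0 expr1n !mulr1; apply: le_trans (ler_norm _) _.
  exact: coef_simplex_bound.
by move=> i _; rewrite expr0n subn_eq0 leqNgt ltn_ord /= mulr0.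
Qed.

(** Settles d = 0: then E = 0 whatever m is, but f itself is a sum of squares of degree at most m,
    which the factor m + 1 of the bound covers. *)
Lemma constant_in_X (R : realType) (n : nat) (f : {poly {mpoly R[n]}}) (x : 'rV[R]_n) :
  degX f = 0%N -> (forall y, 0 < evalXY f x y) ->
  is_sos f /\ (degXY f <= degY f)%N.
Proof.
move=> d0 pos; pose p : {poly R} := evalX f x.
have fE : f = map_poly (@mpolyC n R) p.
  apply/polyP => i; rewrite !coef_map /=.
  have : (msize f`_i <= 1)%N by have := msize_coef f i; rewrite d0.
  by move=> /msize1_polyC ->; rewrite mevalC.
split.
  rewrite fE; apply: is_sos_morph; apply: nonneg_poly_sos => y.
  by rewrite horner_evalX ltW.
apply: degXY_le; rewrite fE; apply: tdeg_le_map.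
by rewrite -fE; apply: leq_trans (size_poly _ _) (leqSpred _).
Qed.

(** For t = L / fb, t (d + 1) >= 1 and d >= 1 give 1 <= 2 t d, hence (m + 1) d <= 2 E: one of the
    two factors d in E compensates for a small t. So d and m + 1 are at most 2 E, t is at most E,
    and a is the integer part of 2 E plus 1. *)
Lemma growth_parameter (R : realType) (L fb : R) (m d : nat) : 0 < fb -> 0 <= L ->
  (0 < d)%N -> fb <= L * (d%:R + 1) ->
  exists2 a : nat, [/\ (1 < a)%N, (d <= a)%N, (m.+1 <= a)%N & L <= a%:R * fb] &
    a%:R <= 2 * (L * (m%:R + 1) * d%:R ^+ 2 / fb) + 1.
Proof.
move=> fb0 L0 d0 Hfb; set E := _ / fb.
have d1 : 1 <= d%:R :> R by rewrite ler1n.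
have m0 : 0 <= m%:R :> R by [].
pose t := L / fb; have t0 : 0 <= t by rewrite divr_ge0 // ltW.
have tE : E = t * (m%:R + 1) * d%:R ^+ 2 by rewrite /E /t; ring.
have t1 : 1 <= t * (d%:R + 1) by rewrite /t mulrAC ler_pdivlMr // mul1r.
have dd : d%:R + 1 <= 2 * d%:R :> R by lra.
have td : 1 <= 2 * (t * d%:R).
  by apply: (le_trans t1); rewrite mulrCA ler_wpM2l.
have dm : (m%:R + 1) * d%:R <= 2 * E.
  have := ler_wpM2r (_ : 0 <= (m%:R + 1) * d%:R) td.
  by rewrite mul1r tE => /(_ (mulr_ge0 (addr_ge0 m0 ler01) (ler0n _ _))) /le_trans; apply;
    rewrite le_eqVlt; apply/orP; left; apply/eqP; ring.
have Et : t <= E.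
  rewrite tE -mulrA ler_peMr // mulr_ege1 ?exprn_ege1 // lerDr //.
have m1E : m%:R + 1 <= 2 * E by apply: le_trans dm; rewrite ler_peMr // addr_ge0.
have dE : d%:R <= 2 * E by apply: le_trans dm; rewrite ler_peMl // lerDr.
have E1 : 1 <= 2 * E by apply: le_trans dE.
have E0 : 0 <= 2 * E by apply: le_trans E1.
have aS := truncnS_gt (2 * E).
exists (Num.truncn (2 * E)).+1; last first.
  by rewrite -natr1 lerD2r truncn_le.
split.
- by rewrite ltnS truncn_gt0.
- by rewrite -(ler_nat R); apply: le_trans (ltW aS).
- by rewrite -(ler_nat R) -natr1; apply: le_trans (ltW aS).
- rewrite -ler_pdivrMr //; apply: (le_trans Et); apply: le_trans (ltW aS); lra.
Qed.

Theorem proposition10 (R : realType) (n s : nat) (hn : (0 < n)%N) (hs : (0 < s)%N)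
    (g : 'I_s -> {mpoly R[n]})
    (hS0 : semialg g !=set0)
    (hS : semialg g `<=` (simplex R n)°)
    (harch : archimedean_qm g) :
  exists c : R, 0 < c /\
    forall (f : {poly {mpoly R[n]}}) (d m : nat) (fb : R),
      (forall (x : 'rV[R]_n) (y : R), semialg g x -> 0 < evalXY f x y) ->
      degX f = d ->
      degY f = m ->
      fully_mic m (semialg g) f ->
      is_bullet_min (semialg g) f fb ->
      0 < fb ->
      let B : R := c * (m%:R + 1) * 2 `^ (m%:R / 2) *
        expR ((bullet_norm f * (m%:R + 1) * d%:R ^+ 2 / fb) `^ c) in
      exists (sigma0 : {poly {mpoly R[n]}}) (sigma : 'I_s -> {poly {mpoly R[n]}}),
        [/\ is_sos sigma0,
            forall i : 'I_s, is_sos (sigma i),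
            f = sigma0 + \sum_(i < s) sigma i * (g i)%:P,
            (degXY sigma0)%:R <= B
          & forall i : 'I_s, (degXY (sigma i * (g i)%:P))%:R <= B].
Proof.
have Sg : semialg g `<=` simplex R n by move=> x /hS; apply: interior_subset.
have [x0 Sx0] := hS0.
have [W [K HW] Hcert] := cylinder_certificate hn hs Sg harch.
have [c c1 Hc] := exp_bound_real R K.
have c0 : 0 < c by apply: lt_le_trans c1.
exists c; split=> // f d m fb fpos fd fm ffull fmin fb0 B.
have f_low x y z : semialg g x -> y ^+ 2 + z ^+ 2 = 1 -> fb <= evalXYZ (homogY f) x y z.
  move=> Sx yz; case: fmin => _; apply; exists (x, (y, z)) => //.
set E := _ / fb in B *.
have E0 : 0 <= E.
  by rewrite divr_ge0 ?(ltW fb0) // !mulr_ge0 ?bullet_norm_ge0 ?addr_ge0.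
have p1 : 1 <= 2 `^ (m%:R / 2) :> R.
  apply: (@le_trans _ _ (2 `^ 0)); first by rewrite powRr0.
  by rewrite ler_powR ?divr_ge0 // ler1n.
have m1 : 1 <= m%:R + 1 :> R by rewrite lerDr.
have BE : c * expR (E `^ c) <= B.
  rewrite /B -!mulrA; apply: ler_wpM2l; first exact: ltW.
  rewrite mulrA; apply: ler_peMl; first exact: expR_ge0.
  by rewrite mulr_ege1.
have [d0|dpos] := posnP d.
  have [sf df] := constant_in_X (etrans fd d0) (fun y => fpos x0 y Sx0).
  have mB : m%:R <= B.
    have e1 : 1 <= expR (E `^ c) by rewrite -expR0 ler_expR powR_ge0.
    apply: (@le_trans _ _ (m%:R + 1)); first by rewrite lerDl.
    rewrite /B -mulrA -mulrA mulrCA ler_peMr ?addr_ge0 // mulr_ege1 // mulr_ege1 //.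
  exists f, (fun=> 0); split=> //.
  - by move=> i; apply: is_sos0.
  - by rewrite big1 ?addr0 // => i _; rewrite mul0r.
  - by apply: le_trans mB; rewrite ler_nat -fm.
  - move=> i; apply: le_trans mB; rewrite mul0r ler_nat.
    by apply: degXY_le; apply: tdeg_le0.
have mE := fully_mic_even Sx0 ffull (fun y => fpos x0 y Sx0).
have Hfb : fb <= bullet_norm f * (d%:R + 1).
  by rewrite -fd; apply: (bullet_min_le (Sg _ Sx0)) => y z; apply: f_low.
have [a [a1 da ma La] aE] := growth_parameter m fb0 (bullet_norm_ge0 f) dpos Hfb.
have sf : (size f <= (m./2).*2.+1)%N by rewrite -mE -fm; apply: leqSpred.
have fda : (degX f <= a)%N by rewrite fd.
have ma' : ((m./2).*2.+1 <= a)%N by rewrite -mE.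
have f_low' x y : semialg g x -> fb * (1 + y ^+ 2) ^+ m./2 <= evalXY f x y.
  by move=> Sx; apply: evalXY_homog => [|y' z']; [rewrite fm|apply: f_low].
have [sigma0 [sigma [s0 si fE ds0 dsi]]] := Hcert f m./2 a fb a1 fda sf ma' fb0 La f_low'.
have WB k : (k <= W a)%N -> k%:R <= B.
  move=> kW; apply: le_trans BE; apply: le_trans (Hc E a E0 aE).
  by rewrite ler_nat; apply: leq_trans kW (HW a a1).
exists sigma0, sigma; split=> // [|i]; apply: WB; apply: degXY_le.
  exact: ds0.
exact: dsi.
Qed.
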